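(* There is an absolute constant $b_0>0$ such that the following holds for every $\lambda>0$ and every finite connected transitive graph $\mathbb G$ (with $V$ vertices of degree $\Omega$) for which the triangle condition $\nabla_{p_c}(x,y)\le\delta_{x,y}+a_0$ (for all $x,y\in\mathbb V$) holds at $p_c=p_c(\mathbb G,\lambda)$ for some $a_0\le b_0$, and for which $\lambda V^{1/3}\ge b_0^{-1}$. Let $0\le\gamma\le1$. (i) If $p\le p_c$ then $$\tfrac13\min\{\sqrt\gamma,\gamma\chi(p)\}\le M(p,\gamma)\le\min\{\sqrt{12\gamma},\,\gamma\chi(p)\}.$$ (ii) If $p=p_c+\Omega^{-1}\epsilon\le1$ and $\epsilon\ge0$ then $$M(p,\gamma)\le\sqrt{12\gamma}+13\epsilon.$$ Moreover, let $0\le\alpha<1$ and $\rho>0$, and let $N_\alpha=\epsilon^{-2}(\epsilon V^{1/3})^\alpha$. There are a positive constant $c=c(\alpha,\lambda)$ and a constant $b_{13}=b_{13}(\alpha,\lambda,\rho)$ (depending only on the indicated quantities, not on $\mathbb G$) such that if $b_{13}V^{-1/3}\le\epsilon\le1$ (and $0\le\rho N_\alpha^{-1}\le1$) then $$M(p,\rho N_\alpha^{-1})\ge c\,\epsilon\min\{1,\rho^{1/(2-\alpha)}\}.$$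
   Context: $\mathbb G=(\mathbb V,\mathbb B)$ is a finite connected graph with vertex set $\mathbb V$ and bond (edge) set $\mathbb B$. It is transitive: for all $x,y\in\mathbb V$ there is a graph automorphism mapping $x$ to $y$. $V=|\mathbb V|$, and $\Omega$ is the common degree of the vertices. In percolation with parameter $p\in[0,1]$ each bond is independently occupied with probability $p$ and vacant otherwise; $\mathbb P_p,\mathbb E_p$ denote probability and expectation. $x\leftrightarrow y$ means there is a path of occupied bonds from $x$ to $y$ (and $x\leftrightarrow x$ always); $\tau_p(x,y)=\mathbb P_p(x\leftrightarrow y)$; $C(x)$ is the set of vertices connected to $x$; $0\in\mathbb V$ is a fixed vertex; $\chi(p)=\mathbb E_p|C(0)|$, a strictly increasing function of $p$ with $\chi(0)=1$, $\chi(1)=V$. The magnetization is $M(p,\gamma)=\sum_{k=1}^V[1-(1-\gamma)^k]\,\mathbb P_p(|C(0)|=k)$ for $0\le\gamma\le1$. The triangle diagram is $\nabla_p(x,y)=\sum_{u,v\in\mathbb V}\tau_p(x,u)\tau_p(u,v)\tau_p(v,y)$. For $\lambda>0$, the critical threshold $p_c=p_c(\mathbb G,\lambda)$ is the unique solution of $\chi(p_c)=\lambda V^{1/3}$; it is always assumed that $1<\lambda V^{1/3}<V$, so that $p_c$ is well defined and $0<p_c<1$. *)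

(* Defs.v *)
From HB Require Import structures.
From mathcomp Require Import all_boot all_order all_algebra all_fingroup.
From mathcomp Require Import boolp classical_sets reals exp.
Set Implicit Arguments.
Unset Strict Implicit.
Unset Printing Implicit Defensive.
Import Order.TTheory GRing.Theory Num.Theory.
Local Open Scope ring_scope.

Section Graph.
Variable T : finType.

(* A bond is an unordered pair of distinct vertices, so a graph on [T] is a
   set [B] of two-element sets.  The same type carries the configurations of
   percolation: [w \subset B] is the set of occupied bonds. *)
Implicit Types (B w : {set {set T}}) (x y : T).

Definition is_graph B := forall b, b \in B -> #|b| = 2%N.

Definition adjacent B x y := [set x; y] \in B.

Definition connected_by B x y := connect (adjacent B) x y.

Definition connected_graph B := forall x y, connected_by B x y.

Definition automorphism B (phi : {perm T}) :=
  forall u v, adjacent B (phi u) (phi v) = adjacent B u v.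

Definition transitive_graph B :=
  forall x y, exists2 phi : {perm T}, automorphism B phi & phi x = y.

Definition degree B x := #|[set b in B | x \in b]|.

Definition cluster w x := [set y | connected_by w x y].

End Graph.

Section Percolation.
Variables (R : realType) (T : finType) (B : {set {set T}}).
Implicit Types (p : R) (x y : T) (w : {set {set T}}).

Definition weight p w : R := p ^+ #|w| * (1 - p) ^+ #|B :\: w|.

Definition expect p (f : {set {set T}} -> R) : R :=
  \sum_(w in powerset B) weight p w * f w.

Definition prob p (A : pred {set {set T}}) : R :=
  \sum_(w in powerset B | A w) weight p w.

Definition tau p x y : R := prob p (fun w => connected_by w x y).

Definition chi (o : T) p : R := expect p (fun w => #|cluster w o|%:R).

Definition magnetization (o : T) p (gamma : R) : R :=
  \sum_(1 <= k < #|T|.+1)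
    (1 - (1 - gamma) ^+ k) * prob p (fun w => #|cluster w o| == k).

Definition triangle p x y : R :=
  \sum_(u : T) \sum_(v : T) tau p x u * tau p u v * tau p v y.

Definition cbrtV : R := #|T|%:R `^ 3^-1.

(* For a connected transitive graph with [1 < lam * cbrtV < #|T|] the set below
   is a singleton; [xget] picks its element. *)
Definition critical_threshold (o : T) (lam : R) : R :=
  xget 0 [set p : R | 0 <= p <= 1 /\ chi o p = lam * cbrtV]%classic.

Definition triangle_condition p (a : R) :=
  forall x y, triangle p x y <= (x == y)%:R + a.

End Percolation.

Arguments cbrtV : clear implicits.

(* Main.v *)
Require Import Defs.
From HB Require Import structures.
From mathcomp Require Import all_boot all_order all_algebra all_fingroup.
From mathcomp Require Import boolp classical_sets reals exp.
From mathcomp Require Import polyrcf.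
From mathcomp Require Import fintype finset.
From mathcomp Require Import ring lra.
Import Order.TTheory GRing.Theory Num.Theory.
Local Open Scope ring_scope.
Set Implicit Arguments.
Unset Strict Implicit.
Unset Printing Implicit Defensive.

(** Let C be the cluster of the root and chi(p) = E|C|.  Colour every vertex green
    independently with probability gamma; then M(p, gamma) is the probability that C
    contains a green vertex.

    Upper bound at the critical threshold.  Let G be the number of green vertices of C.
    The mean of the positive part of G - 1 is gamma chi - M.  A vertex at which two
    branches that contain green vertices part from each other, and from the root, forces one more
    green vertex, so that the number of such branch points is at most G - 1
    ([branch_point_count]).  It is enough to count the vertices with exactly three
    occupied bonds that lead to three different clusters, one containing the root and
    two containing green vertices.  Under the triangle condition the three clusters are
    almost independent ([three_clusters]), and after averaging over the root the mean
    number of these vertices is about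
    (1/2) (Omega p)^3 (1-p)^Omega chi M^2 ([branch_bound]).  At pc the product
    Omega p is within two percent of 1: it is at least 1 - 1/chi because a cluster grows from
    at most Omega p occupied bonds at the root ([chi_le_degree]), and it is at most about
    1 because distinct bridges end in distinct vertices ([degree_p_le]).  Hence
    gamma chi >= chi M^2 / 12, that is M^2 <= 12 gamma, and by monotonicity the bound
    holds below pc ([mag_upper]).

    Lower bound below the threshold.  The tree-graph bound E|C|^2 <= chi^3 yields
    M >= gamma chi - gamma^2 chi^3 / 2, which suffices as long as gamma chi^2 <= 1.
    For larger gamma one first lowers p until gamma chi^2 = 1 ([mag_lower]).

    Upper bound above the threshold.  By the Aizenman--Barsky inequality
    (1-p) dM/dp <= Omega M E[|C|; no green vertex in C], raising p by eps / Omega has at most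
    the effect of raising gamma by about eps M ([mag_extrapolate]).  Inserted into
    M^2 <= 12 gamma at pc, this gives a quadratic inequality for M ([mag_window]).

    Lower bound above the threshold.  The derivative of M in p counts closed bonds
    between the cluster of the root and the union of the clusters that contain green vertices.
    If S is the complement of that union, a cluster of mean size chi can only arise
    from its part inside S through the boundary of S, so the mean number of
    boundary bonds of that part, times p, is at least 1 - E|C_S| / chi.  This argument is due to
    Duminil-Copin and Tassion, and it gives
    p (1-p) dM/dp >= 1 - M - M / (gamma chi) ([pivotal_mean_ge]).  If gamma chi(pc) >= e, then
    M cannot stay below e / 6 up to pc + e / Omega ([mag_supercritical]).  For
    gamma = rho / N_alpha the condition gamma chi(pc) >= e holds with
    e = eps min(1, rho^(1/(2-alpha))) as soon as eps V^(1/3) is large, since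
    alpha < 1 ([window_scaling]).

    Correlation inequalities enter only through the van den Berg--Kesten inequality
    ([bk]) and through resampling off an explored cluster ([explore]). *)

(** * Bernoulli subsets of a finite set *)

Section ProductMeasure.
Variables (R : comNzRingType) (I : finType).
Implicit Types (B w K L : {set I}) (b : I) (p : R) (f g : {set I} -> R).
Implicit Types (E F : pred {set I}).

(** The ring of values is arbitrary so that [p] may be the variable ['X]: the
    expectation is then a polynomial in [p], and can be differentiated. *)
Definition bexp B p f : R :=
  \sum_(w in powerset B) p ^+ #|w| * (1 - p) ^+ #|B :\: w| * f w.

Lemma eq_bexp B p f g :
  (forall w, w \subset B -> f w = g w) -> bexp B p f = bexp B p g.
Proof.
by move=> fg; apply: eq_bigr => w; rewrite inE => /fg ->.
Qed.

Lemma bexpD B p f g : bexp B p (fun w => f w + g w) = bexp B p f + bexp B p g.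
Proof. by rewrite -big_split; apply: eq_bigr => w _; rewrite mulrDr. Qed.

Lemma bexpZ B p (c : R) f : bexp B p (fun w => c * f w) = c * bexp B p f.
Proof. by rewrite /bexp big_distrr; apply: eq_bigr => w _; rewrite /= mulrCA. Qed.

Lemma bexpZr B p (c : R) f : bexp B p (fun w => f w * c) = bexp B p f * c.
Proof. by rewrite mulrC -bexpZ; apply: eq_bexp => w _; rewrite mulrC. Qed.

Lemma bexpN B p f : bexp B p (fun w => - f w) = - bexp B p f.
Proof. by rewrite -mulN1r -bexpZ; apply: eq_bexp => w _; rewrite mulN1r. Qed.

Lemma bexpB B p f g : bexp B p (fun w => f w - g w) = bexp B p f - bexp B p g.
Proof. by rewrite bexpD bexpN. Qed.

Lemma bexp_sum B p (J : Type) (r : seq J) (P : pred J) (h : J -> {set I} -> R) :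
  bexp B p (fun w => \sum_(j <- r | P j) h j w) = \sum_(j <- r | P j) bexp B p (h j).
Proof.
rewrite /bexp exchange_big; apply: eq_bigr => w _.
by rewrite big_distrr.
Qed.

Lemma bexp_set0 p f : bexp set0 p f = f set0.
Proof.
by rewrite /bexp powerset0 big_set1 setD0 cards0 !expr0 !mul1r.
Qed.

(** Conditioning on one element; with [set_card_ind] this is how all facts on
    [bexp] are proved. *)
Lemma bexpU1 B b p f : b \notin B ->
  bexp (b |: B) p f = (1 - p) * bexp B p f + p * bexp B p (fun w => f (b |: w)).
Proof.
move=> bB; rewrite /bexp (bigID (fun w : {set I} => b \in w)) /= addrC; congr (_ + _).
  rewrite big_distrr /=.
  apply: eq_big => w; rewrite !inE.
    apply/andP/idP => [[wB bw]|wB].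
      apply/subsetP => x xw; move/subsetP/(_ x xw): wB.
      by rewrite !inE => /predU1P[xb|//]; rewrite -xb xw in bw.
    split; first by rewrite (subset_trans wB) // subsetUr.
    by apply: contra bB; apply/subsetP.
  move=> /andP[wB bw].
  have -> : (b |: B) :\: w = b |: (B :\: w).
    by apply/setP => x; rewrite !inE; case: eqVneq => // ->; rewrite bw.
  by rewrite cardsU1 !inE (negPf bB) andbF /= exprS; ring.
rewrite big_distrr /=.
rewrite (reindex_onto (fun w => b |: w) (fun w => w :\ b)) /=; last first.
  by move=> w /andP[_ bw]; rewrite setD1K.
apply: eq_big => w; rewrite !inE eqxx /= ?andbT.
  apply/andP/idP => [[wB /eqP wb]|wB].
    apply/subsetP => x xw; move/subsetP/(_ x): wB.
    by rewrite !inE xw orbT => /(_ isT)/predU1P[xb|//]; move: xw; rewrite -wb !inE xb eqxx.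
  have bw : b \notin w by apply: contra bB; apply/subsetP.
  by rewrite setUS // setU1K.
move=> /andP[wB /eqP wb].
have bw : b \notin w by rewrite -wb !inE eqxx.
have -> : (b |: B) :\: (b |: w) = B :\: w.
  by apply/setP => x; rewrite !inE; case: eqVneq => // ->; rewrite (negPf bB) andbF.
by rewrite cardsU1 bw exprS; ring.
Qed.

Lemma set_card_ind (P : {set I} -> Prop) :
  P set0 -> (forall b B, b \notin B -> P B -> P (b |: B)) -> forall B, P B.
Proof.
move=> P0 PS B; have [n le_n] := ubnP #|B|; elim: n => // n IH in B le_n *.
have [->//|[b bB]] := set_0Vmem B.
rewrite -(setD1K bB); apply: PS; first by rewrite !inE eqxx.
by apply: IH; rewrite (cardsD1 b) bB in le_n.
Qed.

Lemma bexp_cst B p (c : R) : bexp B p (fun=> c) = c.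
Proof.
elim/set_card_ind: B => [|b B bB IH]; first by rewrite bexp_set0.
by rewrite bexpU1 // IH; ring.
Qed.

Lemma bexpU B1 B2 p f : [disjoint B1 & B2] ->
  bexp (B1 :|: B2) p f = bexp B1 p (fun w1 => bexp B2 p (fun w2 => f (w1 :|: w2))).
Proof.
elim/set_card_ind: B1 f => [|b B1 bB IH] f dis.
  by rewrite bexp_set0 set0U; apply: eq_bexp => w _; rewrite set0U.
have bB2 : b \notin B2 by rewrite (disjointFr dis) // setU11.
have {}dis : [disjoint B1 & B2] by apply: disjointWl dis; rewrite subsetUr.
rewrite -setUA bexpU1; last by rewrite inE negb_or bB bB2.
rewrite bexpU1 // IH // IH //; congr (_ + _ * _).
by apply: eq_bexp => w _; apply: eq_bexp => w2 _; rewrite setUA.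
Qed.

Lemma bexp_singleton B p K : K \subset B ->
  bexp B p (fun w => (w == K)%:R) = p ^+ #|K| * (1 - p) ^+ #|B :\: K|.
Proof.
move=> KB; rewrite /bexp (bigD1 K) ?inE //= eqxx mulr1 big1 ?addr0 //.
by move=> w /andP[_ /negPf ->]; rewrite mulr0.
Qed.

Lemma bexp_setI B B' p f : B' \subset B ->
  bexp B p (fun w => f (w :&: B')) = bexp B' p f.
Proof.
move=> B'B; rewrite -{1}(setID B B') setUC (setIidPr B'B) bexpU; last first.
  by rewrite -setI_eq0 setDE -setIA [_ :&: B']setIC setICr setI0.
rewrite -[RHS](bexp_cst (B :\: B') p); apply: eq_bexp => w1 w1B.
apply: eq_bexp => w2 w2B; congr f; apply/setP => x; rewrite !inE.
move/subsetP/(_ x): w1B; move/subsetP/(_ x): w2B; rewrite !inE.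
case: (x \in w1); case: (x \in w2); case: (x \in B') => //.
all: try by move=> /(_ isT).
all: by move=> _ /(_ isT).
Qed.

Lemma bexp_inj B p (s : I -> I) f : injective s -> s @: B = B ->
  bexp B p (fun w => f (s @: w)) = bexp B p f.
Proof.
move=> injs sB; have [s' sK s'K] := injF_bij injs.
have imK : cancel (fun w : {set I} => s @: w) (fun w => s' @: w).
  by move=> w; rewrite -imset_comp -[RHS]imset_id; apply: eq_imset.
have imK' : cancel (fun w : {set I} => s' @: w) (fun w => s @: w).
  by move=> w; rewrite -imset_comp -[RHS]imset_id; apply: eq_imset.
rewrite [RHS]/bexp (reindex (fun w => s @: w)) /=; last by exists (fun w => s' @: w) => w _.
apply: eq_big => w; rewrite !inE.
  by rewrite -{2}sB; apply/idP/idP => [/imsetS->//|/(imsetS s')]; rewrite !imK.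
move=> _; have dB : B :\: (s @: w) = s @: (B :\: w).
  apply/setP => x; rewrite -[x]s'K mem_imset // -{1}sB !inE !mem_imset //.
by rewrite dB !card_imset.
Qed.

End ProductMeasure.

Lemma bexp_exchange (R : comNzRingType) (I J : finType) (B : {set I}) (B' : {set J})
    (p q : R) (F : {set I} -> {set J} -> R) :
  bexp B p (fun w => bexp B' q (F w)) = bexp B' q (fun S => bexp B p (F^~ S)).
Proof. by rewrite [RHS]bexp_sum; apply: eq_bigr => w _; rewrite bexpZ. Qed.

Section ProductMeasureOrder.
Variables (R : realFieldType) (I : finType).
Implicit Types (B w K L : {set I}) (b : I) (p : R) (f g : {set I} -> R).
Implicit Types (E F : pred {set I}).

Lemma le_bexp B p f g : 0 <= p <= 1 ->
  (forall w, w \subset B -> f w <= g w) -> bexp B p f <= bexp B p g.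
Proof.
move=> /andP[p0 p1] fg; apply: ler_sum => w; rewrite inE => /fg fgw.
by rewrite ler_wpM2l // mulr_ge0 // exprn_ge0 // subr_ge0.
Qed.

Lemma bexp_ge0 B p f : 0 <= p <= 1 ->
  (forall w, w \subset B -> 0 <= f w) -> 0 <= bexp B p f.
Proof.
by move=> p01 f0; rewrite -[leLHS](bexp_cst B p 0); apply: le_bexp.
Qed.

Definition increasing_fun f := forall K L, K \subset L -> f K <= f L.

(** The order of the two expectations on [B] minus one element is known by
    induction, and moving mass from [f w] to the larger [f (b |: w)] increases
    the convex combination. *)
Lemma bexp_increasing_p B p q f : 0 <= p <= q -> q <= 1 -> increasing_fun f ->
  bexp B p f <= bexp B q f.
Proof.
move=> /andP[p0 pq] q1; have p1 := le_trans pq q1; have q0 := le_trans p0 pq.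
elim/set_card_ind: B f => [|b B bB IH] f incf; first by rewrite !bexp_set0.
rewrite !bexpU1 //.
have incfb : increasing_fun (fun w => f (b |: w)).
  by move=> K L KL; apply: incf; rewrite setUS.
have h0 := IH f incf; have h1 := IH _ incfb.
have h2 : bexp B q f <= bexp B q (fun w => f (b |: w)).
  by apply: le_bexp => [|w _]; [rewrite q0 | apply: incf; rewrite subsetUr].
nra.
Qed.

Definition upward E := forall K L, K \subset L -> E K -> E L.

(** Disjoint occurrence.  For increasing events a witness may be taken to be any
    subset of the open elements, so that one can give [K] to [E] and all the rest
    of [w] to [F]. *)
Definition box E F : pred {set I} :=
  fun w => [exists K : {set I}, [&& K \subset w, E K & F (w :\: K)]].

Lemma boxP E F w :
  reflect (exists K, [/\ K \subset w, E K & F (w :\: K)]) (box E F w).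
Proof. by apply: (iffP existsP) => -[K /and3P]; exists K. Qed.

Lemma upward_box E F : upward E -> upward F -> upward (box E F).
Proof.
move=> uE uF K L KL /boxP[K' [K'K EK' FK]]; apply/boxP; exists K'; split=> //.
  exact: subset_trans KL.
by apply: uF FK; rewrite setSD.
Qed.

Lemma upward_setU1 E b : upward E -> upward (fun w => E (b |: w)).
Proof. by move=> uE K L KL; apply: uE; rewrite setUS. Qed.

(** The van den Berg--Kesten inequality.  Condition on one element [b], and write
    e0 <= e1 and f0 <= f1 for the probabilities of [E] and [F] given that [b] is
    absent or present.  If [b] is present, [E] and [F] occur disjointly when one of
    them does with the help of [b] and the other without it; these two cases
    overlap at least where [b] is useless.  So the induction hypothesis gives
    (1-2p) e0 f0 + p e1 f0 + p e0 f1, which falls short of the product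
    ((1-p) e0 + p e1) ((1-p) f0 + p f1) by p^2 (e1-e0) (f1-f0).  The restriction
    p <= 1/2 makes the coefficient of e0 f0 nonnegative, and percolation is only
    looked at for small p. *)
Lemma bk B p E F : 0 <= p <= 1 / 2 -> upward E -> upward F ->
  bexp B p (fun w => (box E F w)%:R) <=
  bexp B p (fun w => (E w)%:R) * bexp B p (fun w => (F w)%:R).
Proof.
move=> /andP[p0 p2]; have p01 : 0 <= p <= 1 by lra.
elim/set_card_ind: B E F => [|b B bB IH] E F uE uF.
  rewrite !bexp_set0 -natrM mulnb ler_nat; case: boxP => // -[K []].
  by rewrite subset0 => /eqP -> -> ; rewrite setD0 => ->.
rewrite !bexpU1 //.
pose Eb := fun w => E (b |: w); pose Fb := fun w => F (b |: w).
have uEb : upward Eb by apply: upward_setU1.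
have uFb : upward Fb by apply: upward_setU1.
have h : bexp B p (fun w => (box E F (b |: w))%:R) <=
    bexp B p (fun w => (box Eb F w)%:R) + bexp B p (fun w => (box E Fb w)%:R)
    - bexp B p (fun w => (box E F w)%:R).
  rewrite -bexpD -bexpB; apply: le_bexp => // w wB.
  have bw : b \notin w by apply: contra bB; apply/subsetP.
  have h1 : box E F w -> box Eb F w.
    case/boxP=> K [Kw EK FK]; apply/boxP; exists K; split=> //.
    by apply: uE EK; rewrite subsetUr.
  have h2 : box E F w -> box E Fb w.
    case/boxP=> K [Kw EK FK]; apply/boxP; exists K; split=> //.
    by apply: uF FK; rewrite subsetUr.
  have h3 : box E F (b |: w) -> box Eb F w || box E Fb w.
    case/boxP=> K [Kw EK FK]; have [bK|bK] := boolP (b \in K); apply/orP.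
      left; apply/boxP; exists (K :\ b); split; last 1 first.
      - apply: uF FK; apply/subsetP => x; rewrite !inE.
        by case: eqVneq => [->|]; rewrite ?bK.
      - apply/subsetP => x; rewrite !inE => /andP[xb xK].
        by move/subsetP/(_ x xK): Kw; rewrite !inE (negPf xb).
      - by rewrite /Eb setD1K.
    right; apply/boxP; exists K; split=> //.
      apply/subsetP => x xK; move/subsetP/(_ x xK): Kw.
      by rewrite !inE => /predU1P[xb|//]; rewrite -xb xK in bK.
    by apply: uF FK; rewrite setDUl setSU // subsetDl.
  case: (box E F w) h1 h2 => [/(_ isT) -> /(_ isT) ->|_ _].
    by rewrite addrK lern1 leq_b1.
  rewrite subr0 -natrD ler_nat.
  by move: h3; case: (box E F _) => // /(_ isT); case: (box Eb F w) => //=; case: (box E Fb w).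
have := IH _ _ uE uF; have := IH _ _ uEb uF; have := IH _ _ uE uFb.
have le_b G : upward G -> bexp B p (fun w => (G w)%:R) <= bexp B p (fun w => (G (b |: w))%:R).
  move=> uG; apply: le_bexp => // w _; rewrite ler_nat.
  by have := uG w (b |: w) (subsetUr _ _); case: (G w) => // ->.
have := le_b _ uE; have := le_b _ uF.
move: h; rewrite /Eb /Fb.
move: (bexp B p (fun w => (box E F (b |: w))%:R)) (bexp B p (fun w => (box E F w)%:R)).
move: (bexp B p (fun w => (box (fun w => E (b |: w)) F w)%:R)).
move: (bexp B p (fun w => (box E (fun w => F (b |: w)) w)%:R)).
move: (bexp B p (fun w => (E w)%:R)) (bexp B p (fun w => (E (b |: w))%:R)).
move: (bexp B p (fun w => (F w)%:R)) (bexp B p (fun w => (F (b |: w))%:R)).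
move=> f0 f1 e0 e1 x2 x1 x x0 h0 f01 e01 h2 h1 h.
have k0 : p * x <= p * (x1 + x2 - x0) by rewrite ler_wpM2l.
have k1 : p * x1 <= p * (e1 * f0) by rewrite ler_wpM2l.
have k2 : p * x2 <= p * (e0 * f1) by rewrite ler_wpM2l.
have k3 : (1 - 2 * p) * x0 <= (1 - 2 * p) * (e0 * f0) by rewrite ler_wpM2l //; lra.
(* the defect between the induction hypothesis and the product *)
have k4 : 0 <= p ^+ 2 * ((e1 - e0) * (f1 - f0)).
  by rewrite mulr_ge0 ?sqr_ge0 // mulr_ge0 // subr_ge0.
lra.
Qed.

End ProductMeasureOrder.

(** * Derivatives in the density *)

Section Russo.
Variables (R : realFieldType) (I : finType).
Implicit Types (B w : {set I}) (b : I) (f : {set I} -> {poly R}).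

Lemma horner_bexp B f x : (bexp B 'X f).[x] = bexp B x (fun w => (f w).[x]).
Proof.
rewrite /bexp horner_sum; apply: eq_bigr => w _.
by rewrite !hornerE.
Qed.

(** Russo's formula, for integrands that also depend on the density.  The factor
    [1 - x] turns the sum over pivotal elements into a sum over closed ones. *)
Lemma russo B f x :
  (1 - x) * (bexp B 'X f)^`().[x] =
  bexp B x (fun w => \sum_(b in B :\: w) ((f (b |: w)).[x] - (f w).[x]))
  + (1 - x) * bexp B x (fun w => (f w)^`().[x]).
Proof.
elim/set_card_ind: B f => [|b B bB IH] f.
  by rewrite !bexp_set0 set0D big_set0 add0r.
have E1 : bexp B x (fun w => \sum_(c in (b |: B) :\: w) ((f (c |: w)).[x] - (f w).[x]))
   = (bexp B x (fun w => (f (b |: w)).[x]) - bexp B x (fun w => (f w).[x]))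
   + bexp B x (fun w => \sum_(c in B :\: w) ((f (c |: w)).[x] - (f w).[x])).
  rewrite -bexpB -bexpD; apply: eq_bexp => w wB.
  have bw : b \notin w by apply: contra bB; apply/subsetP.
  have -> : (b |: B) :\: w = b |: (B :\: w).
    by apply/setP => y; rewrite !inE; case: eqVneq => // ->; rewrite bw.
  by rewrite big_setU1 //= inE (negPf bB) andbF.
have E2 : bexp B x (fun w => \sum_(c in (b |: B) :\: (b |: w))
      ((f (c |: (b |: w))).[x] - (f (b |: w)).[x]))
   = bexp B x (fun w => \sum_(c in B :\: w) ((f (b |: (c |: w))).[x] - (f (b |: w)).[x])).
  apply: eq_bexp => w wB.
  have -> : (b |: B) :\: (b |: w) = B :\: w.
    by apply/setP => y; rewrite !inE; case: eqVneq => // ->; rewrite (negPf bB) andbF.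
  by apply: eq_bigr => c _; rewrite setUCA.
have d1 : (1 : {poly R})^`() = 0 by rewrite -polyC1 derivC.
rewrite !bexpU1 // E1 E2 derivD !derivM !derivB derivX d1.
rewrite !(hornerD, hornerN, hornerM, hornerX) -!polyC1 -!polyC0 !hornerC !horner_bexp.
have := congr1 ( *%R (1 - x)) (IH f).
have := congr1 ( *%R x) (IH (fun w => f (b |: w))); lra.
Qed.

End Russo.

Section PolynomialOrder.
Variable R : rcfType.
Implicit Types (p u : {poly R}) (a b c x : R).

Lemma le_poly_deriv p a b c : a <= b ->
  (forall x, a <= x <= b -> c <= p^`().[x]) -> c * (b - a) <= p.[b] - p.[a].
Proof.
rewrite le_eqVlt => /predU1P[->|ab] dp; first by rewrite !subrr mulr0.
have [x] := poly_mvt p ab; rewrite in_itv /= => /andP[ax xb] ->.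
by rewrite ler_wpM2r ?dp ?subr_ge0 ?ltW // ax.
Qed.

(** If [u] were positive at [a], it would be nondecreasing up to its first zero, so
    it could not come down to a nonpositive value at [b]. *)
Lemma poly_barrier u a b : a <= b ->
  (forall x, a <= x <= b -> 0 < u.[x] -> 0 <= u^`().[x]) -> u.[b] <= 0 -> u.[a] <= 0.
Proof.
move=> ab du ub; rewrite leNgt; apply/negP => ua.
have u0 : u != 0 by apply: contraTneq ua => ->; rewrite horner0 ltxx.
have a_lt_b : a < b.
  by rewrite lt_neqAle ab andbT; apply: contraTneq ub => <-; rewrite -ltNge.
have [y [ay yb uy noroot]] : exists y, [/\ a < y, y <= b, u.[y] <= 0 &
    {in `]a, y[, forall z, ~~ root u z}].
  case: (next_rootP u a b) => [u00|y _ uy yab noroot|_ _ _ noroot].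
  - by rewrite u00 eqxx in u0.
  - by exists y; split=> //; rewrite ?uy // ?(itvP yab).
  - by exists b; split.
have [c] := poly_mvt u ay; rewrite in_itv /= => /andP[ac cy] uyE.
have uc : 0 < u.[c].
  rewrite ltNge; apply/negP => uc.
  have nrc : u.[c] != 0 by have := noroot c; rewrite in_itv /= ac cy rootE; apply.
  have [|z] := @poly_ivtoo _ u a c (ltW ac); first by rewrite pmulr_rlt0 // lt_neqAle nrc.
  rewrite in_itv /= => /andP[az zc] rz.
  by have := noroot z; rewrite in_itv /= az (lt_trans zc cy) rz => /(_ isT).
have := du c _ uc; rewrite (ltW ac) (le_trans (ltW cy) yb) => /(_ isT) dc.
have : 0 <= u^`().[c] * (y - a) by rewrite mulr_ge0 // subr_ge0 ltW.
by rewrite -uyE subr_ge0 => /(lt_le_trans ua); rewrite ltNge uy.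
Qed.

End PolynomialOrder.

(** * Auxiliary facts *)

Lemma bexp_p0 (R : realFieldType) (I : finType) (B : {set I}) (f : {set I} -> R) :
  bexp B 0 f = f set0.
Proof.
elim/set_card_ind: B => [|b B bB IH]; first by rewrite bexp_set0.
by rewrite bexpU1 // IH subr0 mul1r mul0r addr0.
Qed.

Lemma bexp_p1 (R : realFieldType) (I : finType) (B : {set I}) (f : {set I} -> R) :
  bexp B 1 f = f B.
Proof.
elim/set_card_ind: B f => [|b B bB IH] f; first by rewrite bexp_set0.
by rewrite bexpU1 // !IH subrr mul0r add0r mul1r.
Qed.

Lemma card_sum_mem (R : pzSemiRingType) (I : finType) (A : {set I}) :
  #|A|%:R = \sum_i (i \in A)%:R :> R.
Proof. by rewrite -sum1_card natr_sum big_mkcond /=; apply: eq_bigr => s _; case: (s \in _). Qed.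

Lemma one_sub_exp_le (R : realFieldType) (g : R) n : 0 <= g <= 1 -> 1 - (1 - g) ^+ n <= g * n%:R.
Proof.
move=> /andP[g0 g1]; elim: n => [|n IH]; first by rewrite expr0 mulr0 subrr.
rewrite exprS -natr1; have : 0 <= (1 - g) ^+ n by rewrite exprn_ge0 // subr_ge0.
have : (1 - g) ^+ n <= 1 by rewrite exprn_ile1 ?subr_ge0 // lerBlDr lerDl.
move: ((1 - g) ^+ n) (n%:R) IH => X N IH X1 X0.
have : g * X <= g by rewrite ler_piMr.
lra.
Qed.

Lemma mul_exp_le (R : realFieldType) (g : R) n : 0 <= g <= 1 -> g * (n%:R * (1 - g) ^+ n) <= 1 - (1 - g) ^+ n.
Proof.
move=> /andP[g0 g1]; elim: n => [|n IH]; first by rewrite expr0 mul0r mulr0 subrr.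
rewrite exprS -natr1; have : 0 <= (1 - g) ^+ n by rewrite exprn_ge0 // subr_ge0.
have : (1 - g) ^+ n <= 1 by rewrite exprn_ile1 ?subr_ge0 // lerBlDr lerDl.
move: ((1 - g) ^+ n) (n%:R) IH => X N IH X1 X0.
have : (1 - g) * (g * (N * X)) <= (1 - g) * (1 - X) by rewrite ler_wpM2l ?subr_ge0.
have : 0 <= g * (1 - X) by rewrite mulr_ge0 ?subr_ge0.
have : 0 <= g * g * X by rewrite !mulr_ge0.
lra.
Qed.

Lemma exp_le_quadratic (R : realFieldType) (g : R) n : 0 <= g <= 1 ->
  (1 - g) ^+ n <= 1 - g * n%:R + g ^+ 2 * n%:R ^+ 2 / 2.
Proof.
move=> /andP[g0 g1]; elim: n => [|n IH]; first by rewrite expr0; lra.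
rewrite exprS -natr1; have N0 : 0 <= n%:R :> R by [].
move: ((1 - g) ^+ n) (n%:R) N0 IH => X N N0 IH.
have : (1 - g) * X <= (1 - g) * (1 - g * N + g ^+ 2 * N ^+ 2 / 2) by rewrite ler_wpM2l ?subr_ge0.
have : 0 <= g * g * g * (N * N) by rewrite !mulr_ge0.
have : 0 <= g * g by rewrite mulr_ge0.
lra.
Qed.

(** * Clusters and exploration *)

Section Connectivity.
Variable T : finType.
Implicit Types (w K : {set {set T}}) (x y z s t : T) (A D S : {set T}).

Lemma con_refl w x : connected_by w x x.
Proof. exact: connect0. Qed.

Lemma con_trans w y x z :
  connected_by w x y -> connected_by w y z -> connected_by w x z.
Proof. exact: connect_trans. Qed.

Lemma con_sym w x y : connected_by w x y = connected_by w y x.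
Proof. by apply: sym_connect_sym => u v; rewrite /adjacent setUC. Qed.

Lemma con_edge w x y : [set x; y] \in w -> connected_by w x y.
Proof. exact: connect1. Qed.

Lemma con_mono w w' x y : w \subset w' -> connected_by w x y -> connected_by w' x y.
Proof.
move=> ww'; apply: connect_sub => u v uv; apply: connect1.
exact: (subsetP ww').
Qed.

(** A property that passes along occupied bonds holds on the whole cluster; most
    statements on connections are proved by choosing such a property. *)
Lemma con_ind w (P : T -> Prop) x y :
  (forall u v, [set u; v] \in w -> P u -> P v) -> P x -> connected_by w x y -> P y.
Proof.
move=> stepP Px /connectP[p]; elim: p x Px => [|z p IH] x Px /= => [_ -> //|].
by case/andP=> /stepP/(_ Px) /IH; apply.
Qed.

Lemma mem_cluster w x y : (y \in cluster w x) = connected_by w x y.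
Proof. by rewrite inE. Qed.

Lemma cluster_eq w x y : connected_by w x y -> cluster w x = cluster w y.
Proof.
move=> xy; apply/setP => z; rewrite !inE; apply/idP/idP; apply: con_trans => //.
by rewrite con_sym.
Qed.

(** [off w D] is percolation on the graph from which the vertices of [D] have been
    removed; the vertices of [D] stay, as isolated points. *)
Definition off w D := [set b in w | [disjoint b & D]].

Lemma mem_off w D x y :
  ([set x; y] \in off w D) = [&& [set x; y] \in w, x \notin D & y \notin D].
Proof. by rewrite inE -setI_eq0 setIUl setU_eq0 !setI_eq0 !disjoints1. Qed.

Lemma off_sub w D : off w D \subset w.
Proof. by apply/subsetP => b; rewrite inE => /andP[]. Qed.

Lemma off_mono w w' D : w \subset w' -> off w D \subset off w' D.
Proof.
by move=> /subsetP ww'; apply/subsetP => b; rewrite !inE => /andP[/ww' -> ->].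
Qed.

Lemma offU w D D' : off (off w D) D' = off w (D :|: D').
Proof.
apply/setP => b; rewrite !inE -andbA; congr (_ && _).
by rewrite -!setI_eq0 setIUr setU_eq0.
Qed.

Lemma off_setU w w' D : off (w :|: w') D = off w D :|: off w' D.
Proof. by apply/setP => b; rewrite !inE andb_orl. Qed.

Lemma off_id w D w' : w' \subset off w D -> off w' D = w'.
Proof.
move=> w'w; apply/setP => b; rewrite inE andb_idr // => bw'.
by move: (subsetP w'w b bw'); rewrite inE => /andP[].
Qed.

Lemma off_out w D w' : w' \subset w :\: off w D -> off w' D = set0.
Proof.
move=> w'w; apply/setP => b; rewrite !inE; apply/negP => /andP[bw' bD].
by move: (subsetP w'w b bw'); rewrite !inE bD andbT; case: (b \in w).
Qed.

Lemma con_off_touch w D x y : x \in D -> connected_by (off w D) x y -> y = x.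
Proof.
move=> xD; apply: (con_ind (P := fun u => u = x)) => // u v uv ux.
by move: uv; rewrite mem_off ux xD andbF.
Qed.

Definition hits A S := A :&: S != set0.

Lemma hitsP A S : reflect (exists2 s, s \in A & s \in S) (hits A S).
Proof.
apply: (iffP (set0Pn _)) => [[s /setIP[]]|[s sA sS]]; first by exists s.
by exists s; rewrite inE sA.
Qed.

Lemma hits_mono A A' S : A \subset A' -> hits A S -> hits A' S.
Proof. by move=> AA' /hitsP[s sA sS]; apply/hitsP; exists s; rewrite ?(subsetP AA'). Qed.

Lemma hits1 A x : hits A [set x] = (x \in A).
Proof.
by apply/hitsP/idP => [[s sA]|xA]; [rewrite inE => /eqP <- | exists x; rewrite ?inE].
Qed.

Definition hull w D := [set z | [exists d in D, connected_by w d z]].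

Lemma hullP w D z :
  reflect (exists2 d, d \in D & connected_by w d z) (z \in hull w D).
Proof. by rewrite inE; apply: exists_inP. Qed.

Lemma sub_hull w D : D \subset hull w D.
Proof. by apply/subsetP => d dD; apply/hullP; exists d; rewrite ?con_refl. Qed.

Lemma hull1 w x : hull w [set x] = cluster w x.
Proof.
apply/setP => z; rewrite mem_cluster; apply/hullP/idP => [[d]|xz].
  by rewrite inE => /eqP ->.
by exists x; rewrite ?inE.
Qed.

Lemma mem_hull w D x : (x \in hull w D) = hits (cluster w x) D.
Proof.
apply/hullP/hitsP => -[d]; rewrite ?mem_cluster.
  by move=> dD dx; exists d; rewrite ?mem_cluster 1?con_sym.
by move=> xd dD; exists d; rewrite 1?con_sym.
Qed.

Lemma hull_step w D x y : [set x; y] \in w -> x \in hull w D -> y \in hull w D.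
Proof.
move=> xy /hullP[d dD dx]; apply/hullP; exists d => //.
exact: con_trans dx (con_edge xy).
Qed.

Lemma con_off_hull w D x y : x \notin hull w D ->
  connected_by (off w (hull w D)) x y = connected_by w x y.
Proof.
move=> xh; apply/idP/idP; first by apply: con_mono; apply: off_sub.
move=> xy; suff [] : y \notin hull w D /\ connected_by (off w (hull w D)) x y by [].
apply: (con_ind (P := fun u => u \notin hull w D /\ connected_by (off w (hull w D)) x u)
  _ (conj xh (con_refl _ _)) xy) => u v uv [uh xu].
have vh : v \notin hull w D by apply: contra uh; apply: hull_step; rewrite setUC.
by split=> //; apply: con_trans xu (con_edge _); rewrite mem_off uv uh vh.
Qed.

Lemma cluster_off_hull w D x : x \notin hull w D ->
  cluster (off w (hull w D)) x = cluster w x.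
Proof. by move=> xh; apply/setP => y; rewrite !mem_cluster con_off_hull. Qed.

Lemma cluster_off_cluster w y x : x \notin cluster w y ->
  cluster (off w (cluster w y)) x = cluster w x.
Proof. by rewrite -hull1; apply: cluster_off_hull. Qed.

(** Whether the hull of [D] equals [A] is decided by the bonds that touch [A]
    (here [w1]); the bonds off [A] (here [w2]) remain free. *)
Lemma hull_split B w1 w2 D A : w1 \subset B :\: off B A -> w2 \subset off B A ->
  (hull (w1 :|: w2) D == A) = (hull w1 D == A).
Proof.
move=> w1B w2B.
have w2off u v : [set u; v] \in w2 -> u \notin A.
  by move/(subsetP w2B); rewrite mem_off => /and3P[].
have sub1 : hull w1 D \subset hull (w1 :|: w2) D.
  apply/subsetP => z /hullP[d dD dz]; apply/hullP; exists d => //.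
  by apply: con_mono dz; apply: subsetUl.
have sub2 : hull w1 D \subset A -> hull (w1 :|: w2) D \subset hull w1 D.
  move=> hA; apply/subsetP => z /hullP[d dD].
  apply: (con_ind (P := fun u => u \in hull w1 D)); last exact: (subsetP (sub_hull _ _)).
  move=> u v; rewrite inE => /orP[|/w2off uA uh]; first exact: hull_step.
  by move: (subsetP hA u uh); rewrite (negPf uA).
apply/eqP/eqP => hA; rewrite -hA; apply/eqP; rewrite eqEsubset sub1 sub2 ?andbT //.
  by rewrite -hA.
by rewrite hA.
Qed.

End Connectivity.

Section Exploration.
Variables (R : realFieldType) (T : finType).
Implicit Types (B : {set {set T}}) (p : R) (A D : {set T}).

Lemma bexp_off B p D (f : {set {set T}} -> R) :
  bexp B p (fun w => f (off w D)) = bexp (off B D) p f.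
Proof.
rewrite -(bexp_setI p f (off_sub B D)); apply: eq_bexp => w wB; congr f.
by apply/setP => b; rewrite !inE; case: (boolP (b \in w)) => // /(subsetP wB) ->.
Qed.

Lemma bexp_split_off B p A (F : {set {set T}} -> R) :
  bexp B p F = bexp (B :\: off B A) p (fun w1 =>
    bexp (off B A) p (fun w2 => F (w1 :|: w2))).
Proof.
rewrite -bexpU; last by rewrite -setI_eq0 setDE -setIA [_ :&: off B A]setIC setICr setI0.
by rewrite -[in LHS](setID B (off B A)) (setIidPr (off_sub B A)) setUC.
Qed.

(** Given the hull of [D], the configuration off the hull is fresh percolation on
    the remaining graph: the bonds examined to find the hull all touch it.  Hence
    that part of the configuration can be resampled. *)
Lemma explore B p D (H : {set T} -> {set {set T}} -> R) :
  bexp B p (fun w => H (hull w D) (off w (hull w D))) =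
  bexp B p (fun w => bexp (off B (hull w D)) p (H (hull w D))).
Proof.
have pick (G : {set T} -> {set {set T}} -> R) :
    bexp B p (fun w => G (hull w D) w) =
    \sum_A bexp B p (fun w => (hull w D == A)%:R * G A w).
  rewrite -bexp_sum; apply: eq_bexp => w _.
  rewrite (bigD1 (hull w D)) //= eqxx mul1r big1 ?addr0 // => A.
  by rewrite eq_sym => /negPf ->; rewrite mul0r.
rewrite (pick (fun A w => H A (off w A))) (pick (fun A _ => bexp (off B A) p (H A))).
apply: eq_bigr => A _.
rewrite !(bexp_split_off B p A); apply: eq_bexp => w1 w1B.
under eq_bexp => w2 w2B do rewrite (hull_split D w1B w2B) off_setU (off_out w1B) set0U (off_id w2B).
under [RHS]eq_bexp => w2 w2B do rewrite (hull_split D w1B w2B).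
by rewrite bexpZ bexp_cst.
Qed.

Lemma explore_cluster B p x (H : {set T} -> {set {set T}} -> R) :
  bexp B p (fun w => H (cluster w x) (off w (cluster w x))) =
  bexp B p (fun w => bexp (off B (cluster w x)) p (H (cluster w x))).
Proof.
transitivity (bexp B p (fun w => H (hull w [set x]) (off w (hull w [set x])))).
  by apply: eq_bexp => w _; rewrite hull1.
by rewrite explore; apply: eq_bexp => w _; rewrite hull1.
Qed.

End Exploration.

(** * Disjoint paths *)

Section DisjointPaths.
Variable T : finType.
Implicit Types (w K : {set {set T}}) (x y z s t v : T) (p q : seq T) (A D S Q : {set T}).

Lemma upward_con x y : upward (fun w => connected_by w x y).
Proof. by move=> K L KL; apply: con_mono. Qed.

Lemma cluster_mono w w' x : w \subset w' -> cluster w x \subset cluster w' x.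
Proof. by move=> ww'; apply/subsetP => y; rewrite !mem_cluster; apply: con_mono. Qed.

Lemma upward_hits x S : upward (fun w => hits (cluster w x) S).
Proof. by move=> K L KL; apply: hits_mono; apply: cluster_mono. Qed.

Definition inside w Q := [set b in w | b \subset Q].

Lemma inside_sub w Q : inside w Q \subset w.
Proof. by apply/subsetP => b; rewrite inE => /andP[]. Qed.

Lemma path_mono_in w w' x p :
  {in x :: p &, forall u v, [set u; v] \in w -> [set u; v] \in w'} ->
  path (adjacent w) x p -> path (adjacent w') x p.
Proof. by move=> ww'; apply: (sub_in_path (P := mem (x :: p))) => //; apply/allP. Qed.

Lemma path_inside w x p Q : {subset x :: p <= Q} ->
  path (adjacent w) x p -> path (adjacent (inside w Q)) x p.
Proof.
move=> pQ; apply: path_mono_in => u v up vp uv.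
by rewrite inE uv; apply/subsetP => t /set2P[] ->; apply: pQ.
Qed.

Lemma con_path w x p : path (adjacent w) x p -> connected_by w x (last x p).
Proof. by move=> xp; apply/connectP; exists p. Qed.

Lemma con_upath w x y : connected_by w x y ->
  exists p, [/\ path (adjacent w) x p, uniq (x :: p) & y = last x p].
Proof. by case/connectP=> p xp ->; case/shortenP: xp => q xq uq _; exists q. Qed.

Lemma con_outside w Q x p : path (adjacent w) x p -> {in p, forall u, u \notin Q} ->
  connected_by (w :\: inside w Q) x (last x p).
Proof.
elim: p x => [|y p IH] x /=; first by rewrite con_refl.
case/andP=> xy yp pQ; apply: con_trans (IH y yp _); last first.
  by move=> u up; apply: pQ; rewrite inE up orbT.
apply: con_edge; rewrite !inE [_ \in w]xy /= andbT; apply/negP => /subsetP/(_ y).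
by rewrite !inE eqxx orbT (negPf (pQ y (mem_head _ _))) => /(_ isT).
Qed.

(** The bonds used after [z] contain a vertex that is not on the path up to [z]
    because the path is simple, so the bonds inside the vertex set of the first half
    can be given to the first connection. *)
Lemma box_on_path w x p z : path (adjacent w) x p -> uniq (x :: p) -> z \in x :: p ->
  box (fun K => connected_by K x z) (fun K => connected_by K z (last x p)) w.
Proof.
move=> xp up zp; case/splitPl: zp xp up => p1 p2 zE xp up.
move: xp; rewrite cat_path last_cat zE => /andP[xp1 zp2].
pose Q := [set u in x :: p1].
apply/boxP; exists (inside w Q); split; first exact: inside_sub.
  by rewrite -zE; apply: con_path; apply: path_inside xp1 => u up1; rewrite [_ \in Q]inE.
apply: con_outside => // u up2; rewrite [_ \in Q]inE; apply/negP => up1.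
by move: up; rewrite -cat_cons cat_uniq => /and3P[_ /hasPn/(_ u up2)/=]; rewrite up1.
Qed.

Lemma con_off_or_box w D x y : connected_by w x y ->
  connected_by (off w D) x y \/
  exists2 z, z \in D & box (fun K => connected_by K x z) (fun K => connected_by K z y) w.
Proof.
case/con_upath=> p [xp up ->]; have [/hasP[z zp zD]|/hasPn pD] := boolP (has (mem D) (x :: p)).
  by right; exists z => //; apply: box_on_path.
left; apply: con_path; apply: path_mono_in xp => u v up' vp' uv.
by rewrite mem_off uv; have /= -> := pD u up'; have /= -> := pD v vp'.
Qed.

(** Take a simple path from [x] to [y] and follow a path towards it from [z] until
    it first hits it, at [v].  No bond of the second path has both ends on the first
    one, so the three legs use disjoint sets of bonds. *)
Lemma tripod w x y z : connected_by w x y -> connected_by w x z ->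
  exists v, box (box (fun K => connected_by K x v) (fun K => connected_by K v y))
                (fun K => connected_by K v z) w.
Proof.
case/con_upath=> p [xp up ->] xz; pose Q := [set u in x :: p].
have [v vQ vz] : exists2 v, v \in Q & connected_by (w :\: inside w Q) v z.
  apply: (con_ind (P := fun u => exists2 v, v \in Q & connected_by (w :\: inside w Q) v u)
    _ _ xz) => [u u' uu' [v vQ vu]|]; last by exists x; rewrite ?con_refl // !inE eqxx.
  have [u'Q|u'Q] := boolP (u' \in Q); first by exists u'; rewrite ?con_refl.
  exists v => //; apply: con_trans vu (con_edge _); rewrite !inE uu' andbT /=.
  by apply: contra u'Q => /subsetP; apply; rewrite !inE eqxx orbT.
exists v; apply/boxP; exists (inside w Q); split=> //; first exact: inside_sub.
apply: box_on_path => //; last by move: vQ; rewrite inE.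
by apply: path_inside xp => u up1; rewrite [_ \in Q]inE.
Qed.

(** A path that enters [A] has a first bond from outside [A] into [A]; what
    precedes it lives off [A], and what follows uses other bonds. *)
Lemma box_first_hit w A x z : x \notin A -> connected_by w x z ->
  connected_by (off w A) x z \/
  exists u v, [/\ v \in A, u \notin A & box (fun K => connected_by (off K A) x u)
    (box (fun K => [set u; v] \in K) (fun K => connected_by K v z)) w].
Proof.
move=> xA /con_upath[p [xp up ->]].
have [hasA|/hasPn pA] := boolP (has (mem A) p); last first.
  left; apply: con_path; apply: path_mono_in xp => u v up' vp' uv.
  have pA' t : t \in x :: p -> t \notin A.
    by rewrite inE => /predU1P[->//|/pA].
  by rewrite mem_off uv !pA'.
right; case: (split_find hasA) xp up => v p1 p2 vA p1A xp up.
move: xp; rewrite cat_rcons cat_path last_cat /= => /and3P[xp1 uv vp2].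
move: up; rewrite cat_rcons -cat_cons cat_uniq => /and3P[_ /hasPn p12 /= /andP[vnp2 _]].
set u := last x p1 in uv *; have uxp1 : u \in x :: p1 by apply: mem_last.
have p1A' t : t \in x :: p1 -> t \notin A.
  by rewrite inE => /predU1P[->//|tp1]; apply: contra p1A => tA; apply/hasP; exists t.
pose Q := [set t in x :: p1].
have vQ : v \notin Q by rewrite inE; apply: p12; rewrite mem_head.
exists u, v; split=> //; first exact: p1A'.
apply/boxP; exists (inside w Q); split; first exact: inside_sub.
  apply: con_path; apply: path_mono_in xp1 => s t sp tp st.
  rewrite mem_off !p1A' // andbT [_ \in inside _ _]inE st !andbT /=; apply/subsetP => r.
  by rewrite in_set2 [r \in Q]inE => /orP[]/eqP ->.
apply/boxP; exists [set [set u; v]]; split; last 1 first.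
- apply: con_path; apply: path_mono_in vp2 => s t sp tp st.
  have snQ r : r \in v :: p2 -> r \notin Q by rewrite inE [r \in Q]inE; apply: p12.
  rewrite !inE st andbT /=; apply/andP; split.
    apply/eqP => E; have : u \in [set s; t] by rewrite E !inE eqxx.
    by rewrite in_set2 => /orP[]/eqP uE; [have := p12 s sp|have := p12 t tp]; rewrite -uE uxp1.
  apply/negP => /= /subsetP/(_ s); rewrite in_set2 eqxx => /(_ isT) sQ.
  by have := snQ s sp; rewrite sQ.
- rewrite sub1set !inE [_ \in w]uv andbT; apply/negP => /subsetP/(_ v).
  by rewrite in_set2 eqxx orbT => /(_ isT) vQ'; move: vQ; rewrite vQ'.
- by rewrite inE.
Qed.

End DisjointPaths.

(** * Green vertices and hitting functionals *)

Section Percolation.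
Variables (R : realType) (T : finType).
Implicit Types (B w : {set {set T}}) (p g : R) (x y z a b c v : T) (A D S : {set T}).
Implicit Types (h : {set T} -> R).

Lemma probE B p (A : pred {set {set T}}) : prob B p A = bexp B p (fun w => (A w)%:R).
Proof.
rewrite /prob big_mkcondr; apply: eq_bigr => w _.
by case: (A w); rewrite ?mulr1 ?mulr0.
Qed.

Lemma tauE B p x y : tau B p x y = bexp B p (fun w => (connected_by w x y)%:R).
Proof. exact: probE. Qed.

Lemma chiE B x p : chi B x p = bexp B p (fun w => #|cluster w x|%:R).
Proof. by []. Qed.

Lemma magnetizationE B x p g :
  magnetization B x p g = bexp B p (fun w => 1 - (1 - g) ^+ #|cluster w x|).
Proof.
rewrite /magnetization; under eq_bigr => k _ do rewrite probE -bexpZ.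
rewrite -bexp_sum; apply: eq_bexp => w _.
have lt_k : (#|cluster w x| < #|T|.+1)%N by rewrite ltnS max_card.
have gt0 : (0 < #|cluster w x|)%N.
  by apply/card_gt0P; exists x; rewrite mem_cluster con_refl.
rewrite (big_cat_nat gt0 (ltnW lt_k)) /= big_nat big1 => [|k /andP[_ kl]].
  by rewrite add0r big_ltn // eqxx mulr1 big_nat big1 ?addr0 // => k /andP[kl _];
     rewrite ltn_eqF ?mulr0.
by rewrite gtn_eqF ?mulr0.
Qed.

Lemma tau_ge0 B p x y : 0 <= p <= 1 -> 0 <= tau B p x y.
Proof. by move=> p01; rewrite tauE bexp_ge0. Qed.

Lemma tau_refl B p x : tau B p x x = 1.
Proof. by rewrite tauE -[RHS](bexp_cst B p 1); apply: eq_bexp => w _; rewrite con_refl. Qed.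

Lemma tau_sym B p x y : tau B p x y = tau B p y x.
Proof. by rewrite !tauE; apply: eq_bexp => w _; rewrite con_sym. Qed.

Lemma prob_misses D (q : R) :
  bexp setT q (fun S => (~~ hits D S)%:R) = (1 - q) ^+ #|D|.
Proof.
have gen (E : {set T}) : bexp E q (fun S => (~~ hits D S)%:R) = (1 - q) ^+ #|D :&: E|.
  elim/set_card_ind: E => [|b E bE IH]; first by rewrite bexp_set0 /hits !setI0 cards0 eqxx.
  rewrite bexpU1 // IH; have [bD|bD] := boolP (b \in D).
    rewrite [X in _ + _ * X](_ : _ = 0) ?mulr0 ?addr0.
      have -> : D :&: (b |: E) = b |: (D :&: E).
        by apply/setP => y; rewrite !inE; case: eqVneq => // ->; rewrite bD.
      by rewrite cardsU1 !inE (negPf bE) andbF exprS.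
    rewrite -[RHS](bexp_cst E q); apply: eq_bexp => w _.
    by have -> : hits D (b |: w) by apply/hitsP; exists b; rewrite ?setU11.
  have -> : D :&: (b |: E) = D :&: E.
    by apply/setP => y; rewrite !inE; case: eqVneq => // ->; rewrite (negPf bD).
  have -> : bexp E q (fun S => (~~ hits D (b |: S))%:R) = bexp E q (fun S => (~~ hits D S)%:R).
    apply: eq_bexp => w _; congr (~~ _)%:R; rewrite /hits.
    suff -> : D :&: (b |: w) = D :&: w by [].
    by apply/setP => y; rewrite !inE; case: eqVneq => // ->; rewrite (negPf bD).
  by rewrite IH; ring.
by rewrite gen setIT.
Qed.

(** The probability that [A] contains a green vertex, when the vertices are green
    independently with probability [g]. *)
Definition green_prob g A : R := 1 - (1 - g) ^+ #|A|.

Lemma green_probE g A : green_prob g A = bexp setT g (fun S => (hits A S)%:R).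
Proof.
transitivity (bexp setT g (fun S => 1 - (~~ hits A S)%:R)).
  by rewrite bexpB bexp_cst prob_misses.
by apply: eq_bexp => S _; case: (hits A S); rewrite ?subr0 ?subrr.
Qed.

Lemma green_card g A : bexp setT g (fun S => #|A :&: S|%:R) = g * #|A|%:R.
Proof.
rewrite -sum1_card natr_sum big_distrr /=.
transitivity (\sum_(a in A) bexp setT g (fun S => (a \in S)%:R)).
  rewrite -bexp_sum; apply: eq_bexp => S _.
  rewrite -sum1_card natr_sum big_mkcond [RHS]big_mkcond /=; apply: eq_bigr => a _.
  by rewrite inE; case: (a \in A); case: (a \in S).
apply: eq_bigr => a _; rewrite mulr1.
have := green_probE g [set a]; rewrite /green_prob cards1 expr1 opprB addrC subrK => E.
rewrite [RHS]E; apply: eq_bexp => S _; congr (_ %:R); congr nat_of_bool.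
by apply/idP/hitsP => [aS|[b]]; [exists a; rewrite ?inE | rewrite inE => /eqP ->].
Qed.

Lemma green_both g A A' : [disjoint A & A'] ->
  bexp setT g (fun S => (hits A S && hits A' S)%:R) = green_prob g A * green_prob g A'.
Proof.
move=> dis; have hU S : hits (A :|: A') S = hits A S || hits A' S.
  by rewrite /hits setIUl setU_eq0 negb_and.
transitivity (bexp setT g (fun S => 1 - (~~ hits A S)%:R - (~~ hits A' S)%:R
    + (~~ hits (A :|: A') S)%:R)).
  apply: eq_bexp => S _; rewrite hU.
  by case: (hits A S); case: (hits A' S) => /=; ring.
rewrite bexpD !bexpB bexp_cst !prob_misses cardsU (disjoint_setI0 dis) cards0 subn0 exprD.
rewrite /green_prob; ring.
Qed.

(** A positive combination of the events that [A] meets a target set [S].  The two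
    cases of interest are [#|A|], whose mean over clusters is chi, and
    [green_prob g A], whose mean is the magnetization.  As the targets are fixed sets,
    disjoint occurrence applies to each of them and the bounds below hold for both. *)
Definition hitting h :=
  exists2 mu : {set T} -> R, forall S, 0 <= mu S &
    forall A, h A = \sum_S mu S * (hits A S)%:R.

Lemma hitting_card : hitting (fun A => #|A|%:R).
Proof.
exists (fun S => \sum_x (S == [set x])%:R) => [S|A]; first exact: sumr_ge0.
under eq_bigr => S _ do rewrite big_distrl /=.
rewrite exchange_big /= -sum1_card natr_sum big_mkcond /=; apply: eq_bigr => x _.
rewrite (bigD1 [set x]) //= eqxx mul1r hits1 big1 ?addr0; first by case: (x \in A).
by move=> S /negPf ->; rewrite mul0r.
Qed.

Lemma hitting_green g : 0 <= g <= 1 -> hitting (green_prob g).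
Proof.
case/andP=> g0 g1; exists (fun S => g ^+ #|S| * (1 - g) ^+ #|setT :\: S|).
  by move=> S; rewrite mulr_ge0 // exprn_ge0 // subr_ge0.
move=> A; rewrite green_probE; apply: eq_bigl => S.
by rewrite inE finset.subsetT.
Qed.

Lemma hitting_mono h A A' : hitting h -> A \subset A' -> h A <= h A'.
Proof.
case=> mu mu0 hE AA'; rewrite !hE; apply: ler_sum => S _.
rewrite ler_wpM2l // ler_nat; have := @hits_mono _ A A' S AA'.
by case: (hits A S) => // ->.
Qed.

Lemma hitting_ge0 h A : hitting h -> 0 <= h A.
Proof. by case=> mu mu0 ->; apply: sumr_ge0 => S _; rewrite mulr_ge0. Qed.

Section Bounds.
Variables (B : {set {set T}}) (p : R).
Hypothesis p2 : 0 <= p <= 1 / 2.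
Let p01 : 0 <= p <= 1. Proof. by case/andP: p2 => p0 p_half; apply/andP; split; lra. Qed.

Let P (E : pred {set {set T}}) := bexp B p (fun w => (E w)%:R).
Let ev x S : pred {set {set T}} := fun w => hits (cluster w x) S.

Lemma hits_box_off w D x S : hits (cluster w x) S ->
  hits (cluster (off w D) x) S \/
  exists2 z, z \in D & box (fun K => connected_by K x z) (ev z S) w.
Proof.
case/hitsP=> s; rewrite mem_cluster => /(con_off_or_box D)[xs sS|[z zD]].
  by left; apply/hitsP; exists s; rewrite ?mem_cluster.
case/boxP=> K [Kw xz zs] sS; right; exists z => //; apply/boxP; exists K; split=> //.
by apply/hitsP; exists s; rewrite ?mem_cluster.
Qed.

(** If the connection from [x] to [S] is lost when [D] is removed, it passes
    through some [z] in [D], so that x <-> z and z <-> S occur disjointly. *)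
Lemma prob_off D x S : P (ev x S) <=
  bexp (off B D) p (fun w => (hits (cluster w x) S)%:R)
  + \sum_(z in D) tau B p x z * P (ev z S).
Proof.
apply: (@le_trans _ _ (bexp B p (fun w => (hits (cluster (off w D) x) S)%:R +
   \sum_(z in D) (box (fun K => connected_by K x z) (ev z S) w)%:R))).
  apply: le_bexp => // w _; rewrite /ev.
  case: (boolP (hits _ _)) => [/(hits_box_off D)[->|[z zD bz]]|_].
  - by rewrite lerDl sumr_ge0.
  - rewrite (bigD1 z) //= bz addrA [_ + 1]addrC -addrA lerDl addr_ge0 //.
    exact: sumr_ge0.
  - by rewrite addr_ge0 // sumr_ge0.
rewrite bexpD bexp_sum (bexp_off B p D (fun w => (hits (cluster w x) S)%:R)).
rewrite lerD2l; apply: ler_sum => z _; rewrite tauE.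
by apply: bk => //; [apply: upward_con | apply: upward_hits].
Qed.

(** The tree-graph bound, with a target set as third leaf. *)
Lemma prob_tripod x y S : bexp B p (fun w => (y \in cluster w x)%:R * (hits (cluster w x) S)%:R)
  <= \sum_v tau B p x v * tau B p v y * P (ev v S).
Proof.
pose E v := box (fun K => connected_by K x v) (fun K => connected_by K v y).
apply: (@le_trans _ _ (bexp B p (fun w => \sum_v (box (E v) (ev v S) w)%:R))).
  apply: le_bexp => // w _; rewrite mem_cluster -natrM mulnb.
  case: (boolP (_ && _)) => [/andP[xy /hitsP[s]]|_]; last exact: sumr_ge0.
  rewrite mem_cluster => xs sS; have [v /boxP[K [Kw EK vs]]] := tripod xy xs.
  rewrite (bigD1 v) //= (_ : box _ _ _ = true) ?lerDl ?sumr_ge0 //.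
  by apply/boxP; exists K; split=> //; apply/hitsP; exists s; rewrite ?mem_cluster.
rewrite bexp_sum; apply: ler_sum => v _; rewrite !tauE.
have uE : upward (E v) by apply: upward_box; apply: upward_con.
apply: le_trans (bk B p2 uE (@upward_hits _ v S)) _.
rewrite ler_wpM2r ?bexp_ge0 //.
by apply: bk => //; apply: upward_con.
Qed.

Variables (h : {set T} -> R) (m : R).
Hypotheses (hith : hitting h) (meanh : forall x, bexp B p (fun w => h (cluster w x)) = m).

Lemma mean_off_ge D x : m * (1 - \sum_(z in D) tau B p x z) <=
  bexp (off B D) p (fun w => h (cluster w x)).
Proof.
case: (hith) => mu mu0 hE.
have meanE B' y : bexp B' p (fun w => h (cluster w y)) =
    \sum_S mu S * bexp B' p (fun w => (hits (cluster w y) S)%:R).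
  by under eq_bexp => w _ do rewrite hE; rewrite bexp_sum; under eq_bigr => S _ do rewrite bexpZ.
have sumE : m * \sum_(z in D) tau B p x z =
    \sum_S mu S * \sum_(z in D) tau B p x z * P (ev z S).
  rewrite mulr_sumr; under [RHS]eq_bigr => S _ do rewrite mulr_sumr.
  rewrite exchange_big /=; apply: eq_bigr => z _.
  by rewrite -(meanh z) meanE mulr_suml; apply: eq_bigr => S _; rewrite /P; ring.
rewrite mulrBr mulr1 lerBlDr sumE -(meanh x) !meanE -big_split /=.
by apply: ler_sum => S _; rewrite -mulrDr ler_wpM2l //; apply: prob_off.
Qed.

Lemma mean_off_le D x : bexp (off B D) p (fun w => h (cluster w x)) <= m.
Proof.
rewrite -(meanh x) -(bexp_off B p D (fun w => h (cluster w x))); apply: le_bexp => // w _.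
by apply: hitting_mono => //; apply: cluster_mono; apply: off_sub.
Qed.

Lemma mean_tripod x y : bexp B p (fun w => h (cluster w x) * (y \in cluster w x)%:R)
  <= m * \sum_v tau B p x v * tau B p v y.
Proof.
case: (hith) => mu mu0 hE.
have -> : m * \sum_v tau B p x v * tau B p v y
   = \sum_S mu S * \sum_v tau B p x v * tau B p v y * P (ev v S).
  rewrite mulr_sumr; under [RHS]eq_bigr => S _ do rewrite mulr_sumr.
  rewrite exchange_big /=; apply: eq_bigr => v _.
  rewrite -(meanh v); under eq_bexp => w _ do rewrite hE.
  rewrite bexp_sum mulr_suml; apply: eq_bigr => S _.
  by rewrite bexpZ /P; ring.
under eq_bexp => w _ do rewrite hE mulr_suml.
rewrite bexp_sum; apply: ler_sum => S _.
under eq_bexp => w _ do rewrite -mulrA [_%:R * _]mulrC.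
by rewrite bexpZ ler_wpM2l // prob_tripod.
Qed.

End Bounds.

(** Relabelling the bonds by the automorphism preserves the measure and carries
    the cluster of [x] to the cluster of [phi x]. *)
Lemma bexp_automorphism B p (phi : {perm T}) x (f : nat -> R) : is_graph B ->
  automorphism B phi ->
  bexp B p (fun w => f #|cluster w (phi x)|) = bexp B p (fun w => f #|cluster w x|).
Proof.
move=> gB aphi; pose s (b : {set T}) := phi @: b.
have injs : injective s by apply: imset_inj; apply: perm_inj.
have sB : s @: B = B.
  apply/eqP; rewrite eqEcard card_imset // leqnn andbT.
  apply/subsetP => _ /imsetP[b bB ->]; have /eqP/cards2P[u [v [_ bE]]] := gB b bB.
  have := aphi u v; rewrite /adjacent -bE bB => E.
  by rewrite /s bE imsetU1 imset_set1 E.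
rewrite -(bexp_inj p (fun w => f #|cluster w (phi x)|) injs sB).
apply: eq_bexp => w _; congr f.
have edge u v : ([set phi u; phi v] \in s @: w) = ([set u; v] \in w).
  have -> : [set phi u; phi v] = s [set u; v] by rewrite /s imsetU1 imset_set1.
  by rewrite mem_imset.
suff -> : cluster (s @: w) (phi x) = phi @: cluster w x.
  by rewrite card_imset //; apply: perm_inj.
apply/setP => y; apply/idP/imsetP => [|[z]]; rewrite !mem_cluster.
  move=> xy; exists ((phi^-1)%g y); last by rewrite permKV.
  rewrite mem_cluster.
  have := con_ind (P := fun u => connected_by w x ((phi^-1)%g u)) (x := phi x) _ _ xy.
  rewrite permK; apply; last exact: con_refl.
  move=> u v uv xu; apply: con_trans xu (con_edge _).
  by rewrite -edge !permKV.
move=> xz ->; apply: (con_ind (P := fun u => connected_by (s @: w) (phi x) (phi u)) _ _ xz).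
  by move=> u v uv xu; apply: con_trans xu (con_edge _); rewrite edge.
exact: con_refl.
Qed.

End Percolation.

(** * Near-independence of distinct clusters *)

Section TriangleLower.
Variables (R : realType) (T : finType) (B : {set {set T}}).
Implicit Types (x y : T) (p : R).

Lemma triangle_ge_pair p x y : 0 <= p <= 1 ->
  \sum_v tau B p x v * tau B p v y <= triangle B p x y.
Proof.
move=> p01; rewrite /triangle [leRHS]exchange_big /= [leRHS](bigD1 y) //= tau_refl.
under [X in _ <= X + _]eq_bigr => u _ do rewrite mulr1.
by rewrite lerDl; do 2! apply: sumr_ge0 => ? _; rewrite !mulr_ge0 ?tau_ge0.
Qed.

Lemma triangle_ge_tau p x y : 0 <= p <= 1 -> tau B p x y <= triangle B p x y.
Proof.
move=> p01; apply: le_trans (triangle_ge_pair x y p01).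
by rewrite (bigD1 x) //= tau_refl mul1r lerDl sumr_ge0 // => v _; rewrite mulr_ge0 ?tau_ge0.
Qed.

End TriangleLower.

Section Triangle.
Variables (R : realType) (T : finType) (B : {set {set T}}) (p k : R).
Implicit Types (w : {set {set T}}) (x y z a b c v : T) (A D S : {set T}).
Implicit Types (h : {set T} -> R) (m : R).
Hypotheses (p2 : 0 <= p <= 1 / 2).
Hypothesis tri : forall x y, x != y -> triangle B p x y <= k.
Let p01 : 0 <= p <= 1. Proof. by case/andP: p2 => p0 p_half; apply/andP; split; lra. Qed.

Definition uniform_hitting h m :=
  hitting h /\ forall x, bexp B p (fun w => h (cluster w x)) = m.

(** The expected number of points of [D] in the cluster of [x]. *)
Definition contact D x : R := \sum_(z in D) tau B p x z.

Lemma contactE D x : contact D x = \sum_z (z \in D)%:R * tau B p x z.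
Proof.
rewrite /contact big_mkcond; apply: eq_bigr => z _.
by case: (z \in D); rewrite ?mul1r ?mul0r.
Qed.

Lemma contact_ge0 D x : 0 <= contact D x.
Proof. by apply: sumr_ge0 => z _; apply: tau_ge0. Qed.

Lemma contact_ge1 D x : x \in D -> 1 <= contact D x.
Proof.
move=> xD; rewrite /contact (bigD1 x) //= tau_refl lerDl.
by apply: sumr_ge0 => z _; apply: tau_ge0.
Qed.

Lemma contactU D D' x : contact (D :|: D') x <= contact D x + contact D' x.
Proof.
rewrite !contactE -big_split /=.
apply: ler_sum => z _; rewrite inE; have := tau_ge0 B x z p01.
by case: (z \in D); case: (z \in D') => /=; lra.
Qed.

Lemma contact1 v x : contact [set v] x = tau B p x v.
Proof. by rewrite /contact big_set1. Qed.

Lemma tau_le x y : x != y -> tau B p x y <= k.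
Proof. by move=> xy; apply: le_trans (triangle_ge_tau B x y p01) (tri xy). Qed.

Lemma triangle_k_ge0 x y : x != y -> 0 <= k.
Proof. by move=> xy; apply: le_trans (tau_ge0 B x y p01) (tau_le xy). Qed.

Lemma uniform_ge0 h m x : uniform_hitting h m -> 0 <= m.
Proof. by case=> hh mh; rewrite -(mh x) bexp_ge0 // => w _; apply: hitting_ge0. Qed.

(** By the tree-graph bound, the mean of h(C(b)) times the contact of C(b) with c
    is at most m times the triangle diagram from b to c. *)
Lemma mean_contact h m D b c : uniform_hitting h m -> b != c ->
  bexp (off B D) p (fun w => h (cluster w b) * contact (cluster w b) c) <= m * k.
Proof.
move=> uh bc; have [hh mh] := uh; have m0 := uniform_ge0 b uh.
rewrite -(bexp_off B p D (fun w => h (cluster w b) * contact (cluster w b) c)).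
apply: (@le_trans _ _ (bexp B p (fun w => h (cluster w b) * contact (cluster w b) c))).
  apply: le_bexp => // w _; have sub := @cluster_mono _ (off w D) w b (off_sub w D).
  apply: ler_pM; rewrite ?hitting_ge0 ?contact_ge0 ?hitting_mono //.
  rewrite !contactE; apply: ler_sum => z _; rewrite ler_wpM2r ?tau_ge0 // ler_nat.
  by have := subsetP sub z; case: (z \in _) => // ->.
apply: (@le_trans _ _ (m * triangle B p b c)); last by rewrite ler_wpM2l // tri.
have -> : bexp B p (fun w => h (cluster w b) * contact (cluster w b) c) =
    \sum_z tau B p c z * bexp B p (fun w => h (cluster w b) * (z \in cluster w b)%:R).
  under [RHS]eq_bigr => z _ do rewrite -bexpZ.
  rewrite -bexp_sum; apply: eq_bexp => w _.
  by rewrite contactE mulr_sumr; apply: eq_bigr => z _; ring.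
rewrite /triangle exchange_big /= mulr_sumr; apply: ler_sum => z _.
apply: le_trans (ler_wpM2l (tau_ge0 _ _ _ p01) (mean_tripod p2 hh mh b z)) _.
by rewrite mulrCA (tau_sym B p c z) [tau B p z c * _]mulrC mulr_suml.
Qed.

(** Explore the cluster of [b], then ask for the cluster of [c] off it.  Removing
    sets costs at most their contact with the starting point, and the contact of the
    cluster of [b] with [c] is a triangle.  If [b] or [c] lies in [D] the right
    side vanishes, and the left side is nonpositive because the contact of [D] with
    its own points is at least 1. *)
Lemma two_clusters h2 m2 h3 m3 D b c :
  uniform_hitting h2 m2 -> uniform_hitting h3 m3 -> b != c ->
  m2 * m3 * (1 - k - contact D b - contact D c) <=
  (b \notin D)%:R * (c \notin D)%:R *
  bexp (off B D) p (fun w => h2 (cluster w b) * (c \notin cluster w b)%:R * h3 (cluster w c)).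
Proof.
move=> u2 u3 bc; have [hh2 mh2] := u2; have [hh3 mh3] := u3.
have m20 := uniform_ge0 b u2; have m30 := uniform_ge0 b u3.
have k0 := triangle_k_ge0 bc.
have cb0 := contact_ge0 D b; have cc0 := contact_ge0 D c.
have [bD|bD] := boolP (b \in D).
  rewrite mul0r mul0r mulr_ge0_le0 ?mulr_ge0 //.
  by have := contact_ge1 bD; lra.
have [cD|cD] := boolP (c \in D).
  rewrite mulr0 mul0r mulr_ge0_le0 ?mulr_ge0 //.
  by have := contact_ge1 cD; lra.
rewrite !mul1r.
pose H A w := h2 A * (c \notin A)%:R * h3 (cluster w c).
have -> : bexp (off B D) p (fun w => h2 (cluster w b) * (c \notin cluster w b)%:R * h3 (cluster w c))
    = bexp (off B D) p (fun w => H (cluster w b) (off w (cluster w b))).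
  apply: eq_bexp => w _; rewrite /H; have [cb|cb] := boolP (c \in cluster w b).
    by rewrite mulr0 !mul0r.
  by rewrite cluster_off_cluster.
rewrite explore_cluster.
set X := bexp (off B D) p (fun w => h2 (cluster w b)).
set Y := bexp (off B D) p (fun w => h2 (cluster w b) * contact (cluster w b) c).
have XD : m2 * (1 - contact D b) <= X by apply: mean_off_ge.
have Xm : X <= m2 by apply: mean_off_le.
have Yk : Y <= m2 * k by apply: mean_contact.
apply: (@le_trans _ _ (m3 * ((1 - contact D c) * X - Y))).
  rewrite [m2 * m3]mulrC -mulrA ler_wpM2l //.
  have [c1|c1] := lerP (contact D c) 1; nra.
rewrite /X /Y -bexpZ -bexpB -bexpZ; apply: le_bexp => // w _.
set A := cluster w b; rewrite /H bexpZ offU.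
have hA := @hitting_ge0 R T h2 A hh2.
have [cA|cA] := boolP (c \in A).
  rewrite mulr0 mul0r mulr_ge0_le0 //.
  by have := contact_ge1 cA; nra.
rewrite mulr1; apply: le_trans (ler_wpM2l hA (mean_off_ge p2 hh3 mh3 (D :|: A) c)).
have := contactU D A c; rewrite -/(contact (D :|: A) c) => cU.
rewrite mulrA [h2 A * m3]mulrC -mulrA ler_wpM2l //; nra.
Qed.

(** The clusters of three distinct vertices, seen off a fourth one, are distinct and
    independent up to six terms, each bounded by a triangle: [a], [b] and [c] may
    each meet [v], and each pair may be connected. *)
Lemma three_clusters h1 m1 h2 m2 h3 m3 v a b c :
  uniform_hitting h1 m1 -> uniform_hitting h2 m2 -> uniform_hitting h3 m3 ->
  uniq [:: v; a; b; c] -> k <= 1 / 3 ->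
  m1 * m2 * m3 * (1 - 6 * k) <=
  bexp (off B [set v]) p (fun w => h1 (cluster w a) * (b \notin cluster w a)%:R *
    (c \notin cluster w a)%:R * (h2 (cluster w b) * (c \notin cluster w b)%:R * h3 (cluster w c))).
Proof.
move=> u1 u2 u3; rewrite /= !inE !negb_or => /and4P[/and3P[va vb vc] /andP[ab ac] bc _] k3.
have [hh1 mh1] := u1.
have m10 := uniform_ge0 b u1; have m20 := uniform_ge0 b u2; have m30 := uniform_ge0 b u3.
have k0 := triangle_k_ge0 bc.
pose G w := h2 (cluster w b) * (c \notin cluster w b)%:R * h3 (cluster w c).
pose H A w := h1 A * (b \notin A)%:R * (c \notin A)%:R * G w.
have -> : bexp (off B [set v]) p (fun w => h1 (cluster w a) * (b \notin cluster w a)%:R *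
    (c \notin cluster w a)%:R * (h2 (cluster w b) * (c \notin cluster w b)%:R * h3 (cluster w c)))
  = bexp (off B [set v]) p (fun w => H (cluster w a) (off w (cluster w a))).
  apply: eq_bexp => w _; rewrite /H; have [ba|ba] := boolP (b \in cluster w a).
    by rewrite !(mulr0, mul0r).
  have [ca|ca] := boolP (c \in cluster w a); first by rewrite !(mulr0, mul0r).
  by rewrite /G !cluster_off_cluster.
rewrite explore_cluster.
set X := bexp (off B [set v]) p (fun w => h1 (cluster w a)).
set Y1 := bexp (off B [set v]) p (fun w => h1 (cluster w a) * contact (cluster w a) b).
set Y2 := bexp (off B [set v]) p (fun w => h1 (cluster w a) * contact (cluster w a) c).
have Xk : m1 * (1 - k) <= X.
  apply: le_trans (mean_off_ge p2 hh1 mh1 [set v] a); rewrite ler_wpM2l // lerD2l lerN2.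
  by rewrite big_set1 tau_le // eq_sym.
have Yk1 : Y1 <= m1 * k by apply: mean_contact.
have Yk2 : Y2 <= m1 * k by apply: mean_contact.
apply: (@le_trans _ _ (m2 * m3 * ((1 - 3 * k) * X - Y1 - Y2))).
  have -> : m1 * m2 * m3 * (1 - 6 * k) = m2 * m3 * (m1 * (1 - 6 * k)) by ring.
  rewrite ler_wpM2l ?mulr_ge0 //.
  have : (1 - 3 * k) * (m1 * (1 - k)) <= (1 - 3 * k) * X by rewrite ler_wpM2l //; lra.
  have : 0 <= m1 * (k * k) by rewrite !mulr_ge0.
  lra.
rewrite /X /Y1 /Y2 -bexpZ -!bexpB -bexpZ; apply: le_bexp => // w _.
set A := cluster w a; rewrite /H bexpZ offU.
have hA := @hitting_ge0 R T h1 A hh1.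
have tb : contact ([set v] :|: A) b <= k + contact A b.
  by apply: le_trans (contactU _ _ _) _; rewrite contact1 lerD2r tau_le // eq_sym.
have tc : contact ([set v] :|: A) c <= k + contact A c.
  by apply: le_trans (contactU _ _ _) _; rewrite contact1 lerD2r tau_le // eq_sym.
have := two_clusters ([set v] :|: A) u2 u3 bc.
rewrite !in_setU1 ![_ == v]eq_sym (negPf vb) (negPf vc) /= -/G => h23.
have -> : m2 * m3 * ((1 - 3 * k) * h1 A - h1 A * contact A b - h1 A * contact A c)
   = h1 A * (m2 * m3 * (1 - 3 * k - contact A b - contact A c)) by ring.
have -> : h1 A * (b \notin A)%:R * (c \notin A)%:R * bexp (off B ([set v] :|: A)) p G
   = h1 A * ((b \notin A)%:R * (c \notin A)%:R * bexp (off B ([set v] :|: A)) p G) by ring.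
rewrite ler_wpM2l //.
by apply: le_trans h23; rewrite ler_wpM2l ?mulr_ge0 //; lra.
Qed.

End Triangle.

(** * Branch points *)

Section BranchPoints.
Variable T : finType.
Implicit Types (w : {set {set T}}) (o r s t x y z a b c v : T) (S : {set T}).

(** Follow a path from [s]; it meets one of [r] and [t] first. *)
Lemma con_two_cuts w s t r : connected_by w s t -> r != t ->
  connected_by (off w [set r]) s t \/ connected_by (off w [set t]) s r.
Proof.
move=> st rt; have [->|nst] := eqVneq s t; first by left; apply: con_refl.
have [->|nsr] := eqVneq s r; first by right; apply: con_refl.
pose Q u := [/\ connected_by (off w [set r]) s u, connected_by (off w [set t]) s u,
  u != r & u != t].
have Qs : Q s by split=> //; apply: con_refl.
suff [[_ _ _]|[]] : Q t \/ (connected_by (off w [set r]) s t \/ connected_by (off w [set t]) s r).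
- by rewrite eqxx.
- by left.
- by right.
apply: (con_ind (P := fun u => Q u \/ (connected_by (off w [set r]) s t \/
  connected_by (off w [set t]) s r)) _ (or_introl Qs) st) => u u' uu' [|]; last by right.
case=> ru tu ur ut.
have [u't|u't] := eqVneq u' t.
  right; left; apply: con_trans ru (con_edge _).
  by rewrite mem_off -u't uu' !inE ur u't eq_sym rt.
have [u'r|u'r] := eqVneq u' r.
  right; right; apply: con_trans tu (con_edge _).
  by rewrite mem_off -u'r uu' !inE ut u'r rt.
by left; split=> //; [apply: con_trans ru (con_edge _) | apply: con_trans tu (con_edge _)];
  rewrite mem_off uu' !inE ?ur ?ut ?u'r ?u't.
Qed.

Definition separates w o v x :=
  [&& connected_by w o x, x != v & ~~ connected_by (off w [set v]) o x].

(** [v] cuts the root [o] from two or more points of [S]; [x] is one of these points,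
    it is the least point of [S] (in the enumeration of [T]) in its own component
    off [v], and some smaller point of [S] is also cut off by [v]. *)
Definition branch_point w S o v x :=
  [&& connected_by w o v, v != o, x \in S, separates w o v x,
      [forall (y | y \in S), connected_by (off w [set v]) x y ==> (enum_rank x <= enum_rank y)%N]
    & [exists (y | y \in S), separates w o v y && (enum_rank y < enum_rank x)%N]].

(** If [v'] lay in the component of [x] off [v], then all points that [v'] separates
    from [o] would lie there too, and the one that is smaller than [x] would contradict
    the minimality of [x]. *)
Lemma branch_point_cut w S o v v' x : v != v' ->
  branch_point w S o v x -> branch_point w S o v' x ->
  ~ connected_by (off w [set v]) x v'.
Proof.
move=> vv' /and5P[ov _ xS /and3P[ox _ sx] /andP[/forallP minx _]].
move=> /and5P[ov' _ _ _ /andP[_ /existsP[y /and3P[yS /and3P[oy _ sy] yx]]]] xv'.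
have nov' : ~ connected_by (off w [set v]) o v'.
  by move=> h; case/negP: sx; apply: con_trans h _; rewrite con_sym.
have ov2 : connected_by (off w [set v']) o v.
  have v'v : v' != v by rewrite eq_sym.
  by have [|h] := con_two_cuts ov v'v; last by case: (nov' h).
have yv' : connected_by w y v' by apply: con_trans ov'; rewrite con_sym.
have [h|h] := con_two_cuts yv' vv'.
  have xy : connected_by (off w [set v]) x y by apply: con_trans xv' _; rewrite con_sym.
  by have := minx y; rewrite yS xy /= leqNgt yx.
by case/negP: sy; apply: con_trans ov2 _; rewrite con_sym.
Qed.

(** A path from [x] to [v] or to [v'] meets one of them first, so one of the two lies
    in the component of [x] off the other. *)
Lemma branch_point_inj w S o v v' x :
  branch_point w S o v x -> branch_point w S o v' x -> v = v'.
Proof.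
move=> bv bv'; apply/eqP; apply/negPn/negP => vv'.
have xv : connected_by w x v.
  case/and5P: bv => ov _ _ /and3P[ox _ _] _.
  by apply: con_trans ov; rewrite con_sym.
have v'v : v' != v by rewrite eq_sym.
have [|] := con_two_cuts xv v'v.
  exact: branch_point_cut v'v bv' bv.
exact: branch_point_cut vv' bv bv'.
Qed.

(** Each branch point is charged to the point [x] of [S], injectively, and the least
    point of [S] in the cluster is never charged.  So there are at most G - 1 branch
    points if the cluster contains G >= 1 points of [S]. *)
Lemma branch_point_count w S o :
  (#|[set v | [exists x, branch_point w S o v x]]| + hits (cluster w o) S
    <= #|cluster w o :&: S|)%N.
Proof.
set C := cluster w o :&: S; set Br := [set v | _].
have [C0|[x0' x0'C]] := set_0Vmem C.
  suff -> : Br = set0 by rewrite cards0 /hits -/C C0 eqxx.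
  apply/setP => v; rewrite !inE; apply/negbTE/negP => /existsP[x /and5P[_ _ xS /and3P[ox _ _] _]].
  have : x \in C by rewrite !inE ox.
  by rewrite C0 inE.
have -> : hits (cluster w o) S by apply/set0Pn; exists x0'.
pose x0 := [arg min_(x < x0' in C) enum_rank x].
have [x0C x0min] : x0 \in C /\ forall y, y \in C -> (enum_rank x0 <= enum_rank y)%N.
  by rewrite /x0; case: arg_minnP.
(* the default value [o] is only taken outside [Br] *)
pose f v := odflt o [pick x | branch_point w S o v x].
have fP v : v \in Br -> branch_point w S o v (f v).
  by rewrite inE => /existsP[x bx]; rewrite /f; case: pickP => [//|/(_ x)]; rewrite bx.
rewrite -(card_in_imset (f := f)); last first.
  by move=> v v' /fP bv /fP bv' E; apply: branch_point_inj bv _; rewrite E.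
rewrite (cardsD1 x0 C) x0C addnC leq_add2l; apply: subset_leq_card.
apply/subsetP => _ /imsetP[v /fP bv ->]; move: bv.
case/and5P=> _ _ xS /and3P[ox _ _] /andP[_ /existsP[y /and3P[yS /and3P[oy _ _] yx]]].
rewrite !inE xS ox !andbT; apply: contraTneq yx => ->.
by rewrite -leqNgt x0min // !inE oy yS.
Qed.

(** [v] has exactly three occupied bonds; they lead to three different components
    off [v], the first of which contains the root while the two others meet [S]. *)
Definition trident w S o v a b c :=
  let w0 := off w [set v] in
  [&& [set e in w | v \in e] == [set [set v; a]; [set v; b]; [set v; c]],
      o \in cluster w0 a, b \notin cluster w0 a, c \notin cluster w0 a, c \notin cluster w0 b
    & hits (cluster w0 b) S && hits (cluster w0 c) S].

Lemma trident_sym w S o v a b c : trident w S o v a b c -> trident w S o v a c b.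
Proof.
move=> /and5P[wE oa ba ca /andP[cb /andP[hb hc]]].
rewrite /trident oa ba ca hb hc; rewrite !mem_cluster con_sym in cb *; rewrite cb !andbT.
by rewrite (eqP wE) setUAC.
Qed.

(** Of the least points of [S] in the components of [b] and [c], the larger one is
    the point to which [v] is charged. *)
Lemma trident_branch_point w S o v a b c : uniq [:: v; a; b; c] ->
  trident w S o v a b c -> exists x, branch_point w S o v x.
Proof.
rewrite /= !inE !negb_or => /and4P[/and3P[va vb vc] _ _ _].
have min_of z : hits (cluster (off w [set v]) z) S -> exists x,
    [/\ connected_by (off w [set v]) z x, x \in S &
     forall y, y \in S -> connected_by (off w [set v]) z y -> (enum_rank x <= enum_rank y)%N].
  case/hitsP=> x0; rewrite mem_cluster => zx0 x0S.
  pose Q := [pred x | (x \in S) && connected_by (off w [set v]) z x].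
  have Q0 : Q x0 by rewrite /= x0S.
  have [x /andP[xS zx] xmin] := @arg_minnP _ x0 Q (fun x => enum_rank x) Q0.
  by exists x; split=> // y yS zy; apply: xmin; rewrite /= yS.
move=> tr; case/and5P: (tr) => /eqP wE oa ba ca /and3P[cb /min_of[xb [bx xbS xbmin]]].
case/min_of=> [xc [cx xcS xcmin]].
wlog lt_bc : b c vb vc tr wE ba ca cb xb bx xbS xbmin xc cx xcS xcmin /
    (enum_rank xb < enum_rank xc)%N.
  move=> W; have [|lt|E] := ltngtP (enum_rank xb) (enum_rank xc).
  - exact: (W b c vb vc tr wE ba ca cb xb bx xbS xbmin xc cx xcS xcmin).
  - apply: (W c b vc vb (trident_sym tr) _ ca ba _ xc cx xcS xcmin xb bx xbS xbmin lt).
      by rewrite wE setUAC.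
    by move: cb; rewrite !mem_cluster con_sym.
  case/negP: cb; rewrite mem_cluster; apply: con_trans bx _.
  by rewrite (enum_rank_inj (val_inj E)) con_sym.
move: oa ba ca cb; rewrite !mem_cluster => ao ab ac bc.
have edge z : z \in [:: a; b; c] -> connected_by w v z.
  move=> zabc; apply: con_edge; suff : [set v; z] \in [set e in w | v \in e].
    by rewrite inE => /andP[].
  by rewrite wE !inE; move: zabc; rewrite !inE => /or3P[]/eqP ->; rewrite eqxx ?orbT.
have up y z : connected_by (off w [set v]) y z -> connected_by w y z.
  by apply: con_mono; apply: off_sub.
have not_v z y : v != z -> connected_by (off w [set v]) z y -> y != v.
  move=> vz zy; apply: contraNneq vz => yv; apply/eqP.
  by apply/esym/(con_off_touch (D := [set v]) (w := w)); rewrite ?inE // con_sym -{2}yv.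
have ov : connected_by w o v.
  by rewrite con_sym; apply: con_trans (edge a _) (up _ _ ao); rewrite !inE eqxx.
have sep z y : z \in [:: a; b; c] -> v != z -> ~~ connected_by (off w [set v]) a z ->
    connected_by (off w [set v]) z y -> separates w o v y.
  move=> zabc vz az zy; apply/and3P; split; last 1 first.
  - apply: contra az => oy; apply: con_trans ao (con_trans oy _).
    by rewrite con_sym.
  - exact: con_trans ov (con_trans (edge z zabc) (up _ _ zy)).
  - exact: not_v zy.
exists xc; apply/and5P; split=> //.
- by rewrite eq_sym; apply: not_v ao.
- by apply: (sep c); rewrite ?inE ?eqxx ?orbT.
apply/andP; split.
  apply/forallP => y; apply/implyP => yS; apply/implyP => xcy; apply: xcmin => //.
  exact: con_trans cx xcy.
apply/existsP; exists xb; rewrite xbS lt_bc andbT /=.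
by apply: (sep b); rewrite ?inE ?eqxx ?orbT.
Qed.

Lemma set2_inj v x y : x != v -> [set v; x] = [set v; y] -> x = y.
Proof.
move=> xv E; have : x \in [set v; y] by rewrite -E !inE eqxx orbT.
by rewrite !inE (negPf xv) => /eqP.
Qed.

Lemma trident_unique w S o v a b c a' b' c' :
  uniq [:: v; a; b; c] -> uniq [:: v; a'; b'; c'] ->
  trident w S o v a b c -> trident w S o v a' b' c' ->
  a' = a /\ ((b' = b /\ c' = c) \/ (b' = c /\ c' = b)).
Proof.
move=> u u' /and5P[/eqP wE oa ba ca _] /and5P[/eqP wE' oa' ba' ca' /andP[cb' _]].
have mem z : z != v -> [set v; z] \in [set e in w | v \in e] -> z \in [:: a; b; c].
  move=> zv; rewrite wE !inE -orbA => /or3P[]/eqP/(set2_inj zv) ->; by rewrite eqxx ?orbT.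
have [v'a' v'b' v'c'] : [/\ a' != v, b' != v & c' != v].
  move: u'; rewrite /= !inE !negb_or => /and4P[/and3P[h1 h2 h3] _ _ _].
  by rewrite ![_ == v]eq_sym.
have {mem} [ma mb mc] : [/\ a' \in [:: a; b; c], b' \in [:: a; b; c] & c' \in [:: a; b; c]].
  by split; apply: mem => //; rewrite wE' !inE eqxx ?orbT.
move: oa ba ca oa' ba' ca' cb'; rewrite !mem_cluster => oa ba ca oa' ba' ca' cb'.
have aa' : connected_by (off w [set v]) a a' by rewrite (con_trans oa) // con_sym.
have a'E : a' = a.
  move: ma; rewrite !inE => /or3P[]/eqP a'E //.
    by case/negP: ba; rewrite -a'E.
  by case/negP: ca; rewrite -a'E.
split=> //; move: mb mc; rewrite !inE.
have -> : (b' == a) = false by apply: contraNF ba' => /eqP ->; rewrite a'E con_refl.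
have -> : (c' == a) = false by apply: contraNF ca' => /eqP ->; rewrite a'E con_refl.
have bc' : b' != c' by apply: contraNneq cb' => ->; rewrite con_refl.
move=> /= /orP[]/eqP bE /orP[]/eqP cE; rewrite bE cE ?eqxx in bc' *; by [left|right|].
Qed.

Lemma sum_nat_le_one (I : finType) (P : pred I) (F : I -> nat) (i0 : I) n :
  (F i0 <= n)%N -> (forall i, P i -> i != i0 -> F i = 0%N) -> (\sum_(i | P i) F i <= n)%N.
Proof.
move=> Fi0 F0; have [Pi0|Pi0] := boolP (P i0).
  rewrite (bigD1 i0) //= big1 ?addn0 // => i /andP[Pi ii0]; exact: F0.
by rewrite big1 // => i Pi; apply: F0 => //; apply: contraNneq Pi0 => <-.
Qed.

Lemma uniq_nbrs (N : {set T}) v a b c : v \notin N -> a \in N -> b \in N :\ a ->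
  c \in N :\ a :\ b -> uniq [:: v; a; b; c].
Proof.
rewrite !inE => vN aN /andP[ba bN] /and3P[cb ca cN].
rewrite /= !inE !negb_or (eq_sym a b) ba (eq_sym a c) ca (eq_sym b c) cb !andbT.
by apply/and3P; split; apply: contraNneq vN => ->.
Qed.

(** The factor 2 is for the order of [b] and [c]; apart from it a vertex determines
    its trident. *)
Lemma trident_count w S o (N : T -> {set T}) : (forall v, v \notin N v) ->
  (\sum_v \sum_(a in N v) \sum_(b in N v :\ a) \sum_(c in N v :\ a :\ b) trident w S o v a b c
    <= 2 * (#|cluster w o :&: S| - hits (cluster w o) S))%N.
Proof.
move=> vN; apply: (@leq_trans (\sum_v 2 * [exists x, branch_point w S o v x])); last first.
  rewrite -big_distrr /= leq_mul2l /= leq_subRL; last first.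
    by apply: leq_trans (branch_point_count w S o); rewrite leq_addl.
  rewrite addnC; apply: leq_trans (branch_point_count w S o).
  by rewrite leq_add2r -sum1dep_card [leqRHS]big_mkcond; apply: leq_sum => v _; case: ifP => // ->.
apply: leq_sum => v _.
have [bp|nbp] := boolP [exists x, branch_point w S o v x]; last first.
  rewrite muln0 leqn0 big1 // => a aN; rewrite big1 // => b bN; rewrite big1 // => c cN.
  apply/eqP; rewrite eqb0; apply: contra nbp => /trident_branch_point[|x bx].
    exact: uniq_nbrs (vN v) aN bN cN.
  by apply/existsP; exists x.
rewrite muln1.
pose good a b c := [&& a \in N v, b \in N v :\ a, c \in N v :\ a :\ b & trident w S o v a b c].
have gu a b c : good a b c -> uniq [:: v; a; b; c] /\ trident w S o v a b c.
  by case/and4P=> aN bN cN tr; split=> //; apply: uniq_nbrs (vN v) aN bN cN.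
have [/existsP[a0 /existsP[b0 /existsP[c0 g0]]]|ng] :=
    boolP [exists a, exists b, exists c, good a b c]; last first.
  rewrite big1 // => a aN; rewrite big1 // => b bN; rewrite big1 // => c cN.
  apply/eqP; rewrite eqb0; apply: contra ng => tr.
  by apply/existsP; exists a; apply/existsP; exists b; apply/existsP; exists c; apply/and4P.
have [u0 t0] := gu _ _ _ g0.
have uni a b c : a \in N v -> b \in N v :\ a -> c \in N v :\ a :\ b ->
    trident w S o v a b c -> a = a0 /\ ((b = b0 /\ c = c0) \/ (b = c0 /\ c = b0)).
  move=> aN bN cN tr; have [|u t] := gu a b c; first exact/and4P.
  exact: trident_unique u0 u t0 t.
apply: (sum_nat_le_one (i0 := a0)); last first.
  move=> a aN aa0; rewrite big1 // => b bN; rewrite big1 // => c cN.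
  by apply/eqP; rewrite eqb0; apply: contraNN aa0 => /uni[] // ->.
have /and4P[a0N _ _ _] := g0.
apply: (@leq_trans (\sum_(b in N v :\ a0) (b \in [set b0; c0]))); last first.
  rewrite -big_mkcondr /= sum1dep_card; apply: leq_trans (_ : #|[set b0; c0]| <= 2)%N.
    by apply: subset_leq_card; apply/subsetP => b; rewrite inE => /andP[].
  by rewrite cards2; case: (_ != _).
apply: leq_sum => b bN.
have [bb|bb] := boolP (b \in [set b0; c0]); last first.
  rewrite leqn0 big1 // => c cN; apply/eqP; rewrite eqb0; apply: contra bb.
  by move=> /(uni _ _ _ a0N bN cN)[_]; rewrite !inE => -[][-> _]; rewrite eqxx ?orbT.
apply: (sum_nat_le_one (i0 := if b == b0 then c0 else b0)); first exact: leq_b1.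
move=> c cN cc; apply/eqP; rewrite eqb0; apply: contraNN cc.
move=> /(uni _ _ _ a0N bN cN)[_] [][-> ->]; first by rewrite eqxx.
by case: (eqVneq c0 b0) => // ->.
Qed.

End BranchPoints.

(** * The quadratic bound on the magnetization *)

Section Transitive.
Variables (R : realType) (T : finType) (B : {set {set T}}) (o : T).
Implicit Types (w : {set {set T}}) (x y z a b c v : T) (A D S : {set T}) (p g : R).
Hypotheses (gB : is_graph B) (trB : transitive_graph B).

Definition nbrs v := [set y | [set v; y] \in B].

Lemma nbrs_neq v y : y \in nbrs v -> y != v.
Proof.
by rewrite inE => /gB; apply: contra_eqN => /eqP ->; rewrite setUid cards1.
Qed.

Lemma nbrs_irrefl v : v \notin nbrs v.
Proof. by apply/negP => /nbrs_neq; rewrite eqxx. Qed.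

Lemma star_nbrs v : [set b in B | v \in b] = (fun y => [set v; y]) @: nbrs v.
Proof.
apply/setP => b; rewrite inE; apply/andP/imsetP => [[bB vb]|[y]]; last first.
  by rewrite inE => yB ->; rewrite !inE eqxx.
have /eqP/cards2P[s [t [st bE]]] := gB bB.
move: vb; rewrite bE !inE => /orP[]/eqP vE.
  by exists t; rewrite ?inE vE -?bE.
by exists s; rewrite ?inE vE setUC -?bE.
Qed.

Lemma card_nbrs_degree v : #|nbrs v| = degree B v.
Proof.
rewrite /degree star_nbrs card_in_imset // => y z yv zv.
exact: set2_inj (nbrs_neq yv).
Qed.

Lemma card_nbrs v : #|nbrs v| = degree B o.
Proof.
rewrite -card_nbrs_degree; have [phi aphi <-] := trB o v.
suff -> : nbrs (phi o) = phi @: nbrs o by rewrite card_imset //; apply: perm_inj.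
apply/setP => y; rewrite -[y](permKV phi) mem_imset; last exact: perm_inj.
by rewrite !inE; apply: aphi.
Qed.

Lemma mean_card p x : bexp B p (fun w => #|cluster w x|%:R) = chi B o p.
Proof.
have [phi aphi <-] := trB o x.
exact: (bexp_automorphism p o (fun n => n%:R) gB aphi).
Qed.

Lemma mean_green p g x :
  bexp B p (fun w => green_prob g (cluster w x)) = magnetization B o p g.
Proof.
have [phi aphi <-] := trB o x; rewrite magnetizationE.
exact: (bexp_automorphism p o (fun n => 1 - (1 - g) ^+ n) gB aphi).
Qed.

Lemma uniform_card p : uniform_hitting B p (fun A => #|A|%:R) (chi B o p).
Proof. by split; [apply: hitting_card | apply: mean_card]. Qed.

Lemma uniform_green p g : 0 <= g <= 1 ->
  uniform_hitting B p (green_prob g) (magnetization B o p g).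
Proof. by move=> g01; split; [apply: hitting_green | apply: mean_green]. Qed.

Lemma star_off v : B :\: off B [set v] = [set b in B | v \in b].
Proof.
apply/setP => b; rewrite !inE disjoint_sym disjoints1.
by case: (b \in B); rewrite ?andbF ?andbT ?negbK.
Qed.

Let Omega := degree B o.

Lemma trident_prob p v a b c s S : a \in nbrs v -> b \in nbrs v :\ a -> c \in nbrs v :\ a :\ b ->
  bexp B p (fun w => (trident w S s v a b c)%:R) =
  p ^+ 3 * (1 - p) ^+ (Omega - 3) *
  bexp (off B [set v]) p (fun w => (s \in cluster w a)%:R * (b \notin cluster w a)%:R *
    (c \notin cluster w a)%:R * ((c \notin cluster w b)%:R *
     (hits (cluster w b) S && hits (cluster w c) S)%:R)).
Proof.
move=> aN bN cN; have := uniq_nbrs (nbrs_irrefl v) aN bN cN; rewrite /= !inE !negb_or.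
move=> /and4P[/and3P[va vb vc] /andP[ab ac] bc _].
pose K := [set [set v; a]; [set v; b]; [set v; c]].
have inj2 x y : v != x -> x != y -> [set v; x] != [set v; y].
  by rewrite eq_sym => xv; apply: contra_neq => /set2_inj; apply.
have cK : #|K| = 3%N.
  by rewrite /K -setUA cardsU1 cards2 !inE negb_or !inj2.
have KB : K \subset B :\: off B [set v].
  rewrite star_off; move: aN bN cN; rewrite !inE => aN /andP[_ bN] /and3P[_ _ cN].
  by apply/subsetP => e; rewrite !inE -orbA => /or3P[]/eqP ->; rewrite ?aN ?bN ?cN !inE eqxx.
have cB : #|(B :\: off B [set v]) :\: K| = (Omega - 3)%N.
  rewrite cardsD (setIidPr KB) cK star_off.
  by rewrite -[#|[set _ in _ | _]|]/(degree B v) -card_nbrs_degree card_nbrs.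
rewrite (bexp_split_off B p [set v]) -cB -cK -(bexp_singleton p KB) -bexpZr.
apply: eq_bexp => w1 w1B; rewrite -bexpZ; apply: eq_bexp => w2 w2B.
rewrite /trident off_setU (off_out w1B) set0U (off_id w2B) -/K.
have -> : [set e in w1 :|: w2 | v \in e] = w1.
  apply/setP => e; rewrite !inE; case: (boolP (e \in w1)) => [/(subsetP w1B)|_] /=.
    by rewrite star_off inE => /andP[].
  apply/negbTE; rewrite negb_and; have [/(subsetP w2B)|//] := boolP (e \in w2).
  by rewrite inE disjoint_sym disjoints1 => /andP[].
by rewrite -!mulrA -!natrM !mulnb.
Qed.

(** The bonds at [v] and those off [v] are independent, and the green vertices of
    disjoint sets are independent.  Summing over the root [x] replaces its indicator by
    the size of the cluster of [a]. *)
Lemma trident_mean p g v a b c : 0 <= g <= 1 ->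
  a \in nbrs v -> b \in nbrs v :\ a -> c \in nbrs v :\ a :\ b ->
  \sum_x bexp setT g (fun S => bexp B p (fun w => (trident w S x v a b c)%:R)) =
  p ^+ 3 * (1 - p) ^+ (Omega - 3) *
  bexp (off B [set v]) p (fun w => #|cluster w a|%:R * (b \notin cluster w a)%:R *
    (c \notin cluster w a)%:R * (green_prob g (cluster w b) * (c \notin cluster w b)%:R *
     green_prob g (cluster w c))).
Proof.
move=> g01 aN bN cN.
under eq_bigr => x _ do under eq_bexp => S _ do rewrite trident_prob //.
under eq_bigr => x _ do rewrite bexpZ -bexp_exchange.
rewrite -mulr_sumr; congr (_ * _); rewrite -bexp_sum; apply: eq_bexp => w _.
under eq_bigr => x _ do rewrite bexpZ bexpZ.
have [cb|cb] := boolP (c \in cluster w b).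
  by rewrite !(mulr0, mul0r) big1 // => x _; rewrite mulr0.
rewrite mul1r green_both; last first.
  rewrite -setI_eq0; apply/eqP/setP => z; rewrite !inE; apply/negP => /andP[bz cz].
  by case/negP: cb; rewrite mem_cluster; apply: con_trans bz _; rewrite con_sym.
rewrite mulr1 -sum1_card natr_sum !big_distrl [RHS]big_mkcond /=; apply: eq_bigr => x _.
by case: (x \in cluster w a); rewrite ?mul0r ?mul1r.
Qed.

(** If G is the number of green vertices in the cluster, then g chi - M is the mean of
    the positive part of G - 1, which bounds the mean number of branch points.  By
    transitivity the mean can be taken over all roots, and then each ordered triple of
    neighbours of each vertex contributes the same lower bound. *)
Lemma branch_bound p g k : 0 <= p <= 1 / 2 -> 0 <= g <= 1 -> 0 <= k <= 1 / 3 ->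
  (forall x y, x != y -> triangle B p x y <= k) ->
  (Omega * Omega.-1 * Omega.-2)%:R * (p ^+ 3 * (1 - p) ^+ (Omega - 3)) *
    (chi B o p * magnetization B o p g ^+ 2 * (1 - 6 * k)) <=
  2 * (g * chi B o p - magnetization B o p g).
Proof.
move=> p2 g01 /andP[k0 k3] tri.
have p01 : 0 <= p <= 1 by case/andP: p2 => p0 p_half; apply/andP; split; lra.
set q := p ^+ 3 * _; set X := chi B o p * _ * _.
have q0 : 0 <= q by rewrite mulr_ge0 // exprn_ge0 //; lra.
have V0 : 0 < #|T|%:R :> R by rewrite ltr0n; apply/card_gt0P; exists o.
rewrite -(ler_pM2l V0).
have mean x : g * chi B o p - magnetization B o p g =
   bexp setT g (fun S => bexp B p (fun w => #|cluster w x :&: S|%:R - (hits (cluster w x) S)%:R)).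
  rewrite -bexp_exchange -(mean_card p x) -(mean_green p g x) -bexpZ -bexpB.
  by apply: eq_bexp => w _; rewrite bexpB green_card green_probE.
have VE : #|T|%:R * (2 * (g * chi B o p - magnetization B o p g)) =
   \sum_x bexp setT g (fun S => bexp B p (fun w =>
     2 * (#|cluster w x :&: S|%:R - (hits (cluster w x) S)%:R))).
  rewrite -sum1_card natr_sum big_distrl /=; apply: eq_bigr => x _.
  by rewrite mul1r (mean x) -bexpZ; apply: eq_bexp => S _; rewrite bexpZ.
rewrite {mean}VE.
apply: (@le_trans _ _ (\sum_x bexp setT g (fun S => bexp B p (fun w =>
   \sum_v \sum_(a in nbrs v) \sum_(b in nbrs v :\ a) \sum_(c in nbrs v :\ a :\ b)
      (trident w S x v a b c)%:R)))); last first.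
  apply: ler_sum => x _; apply: le_bexp => // S _; apply: le_bexp => // w _.
  have le_h : (hits (cluster w x) S <= #|cluster w x :&: S|)%N.
    by apply: leq_trans (branch_point_count w S x); rewrite leq_addl.
  rewrite -natrB // -natrM.
  have := trident_count w S x nbrs_irrefl; rewrite -(ler_nat R); apply: le_trans.
  by do 4! (rewrite natr_sum; apply: ler_sum => ? _).
have -> : \sum_x bexp setT g (fun S => bexp B p (fun w =>
   \sum_v \sum_(a in nbrs v) \sum_(b in nbrs v :\ a) \sum_(c in nbrs v :\ a :\ b)
      (trident w S x v a b c)%:R)) =
  \sum_v \sum_(a in nbrs v) \sum_(b in nbrs v :\ a) \sum_(c in nbrs v :\ a :\ b)
   \sum_x bexp setT g (fun S => bexp B p (fun w => (trident w S x v a b c)%:R)).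
  under eq_bigr => x _ do under eq_bexp => S _ do rewrite bexp_sum.
  under eq_bigr => x _ do rewrite bexp_sum.
  rewrite exchange_big; apply: eq_bigr => v _ /=.
  do 3! (under eq_bigr => x _ do under eq_bexp => S _ do rewrite bexp_sum;
  under eq_bigr => x _ do rewrite bexp_sum;
  rewrite exchange_big; apply: eq_bigr => ? _ /=).
  by [].
have -> : #|T|%:R * ((Omega * Omega.-1 * Omega.-2)%:R * q * X) =
  \sum_v \sum_(a in nbrs v) \sum_(b in nbrs v :\ a) \sum_(c in nbrs v :\ a :\ b) (q * X).
  rewrite -sum1_card natr_sum big_distrl /=; apply: eq_bigr => v _; rewrite mul1r.
  transitivity (\sum_(a in nbrs v) (Omega.-1 * Omega.-2)%:R * (q * X)).
    by rewrite sumr_const card_nbrs -[RHS]mulr_natl /Omega !natrM !mulrA.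
  apply: eq_bigr => a aN.
  have ca : #|nbrs v :\ a| = Omega.-1 by rewrite /Omega -(card_nbrs v) (cardsD1 a (nbrs v)) aN.
  transitivity (\sum_(b in nbrs v :\ a) Omega.-2%:R * (q * X)).
    by rewrite sumr_const ca -[RHS]mulr_natl !natrM !mulrA.
  apply: eq_bigr => b bN.
  have cb : #|nbrs v :\ a :\ b| = Omega.-2 by rewrite -ca (cardsD1 b (nbrs v :\ a)) bN.
  by rewrite sumr_const cb -[RHS]mulr_natl.
apply: ler_sum => v _; apply: ler_sum => a aN; apply: ler_sum => b bN; apply: ler_sum => c cN.
rewrite trident_mean // ler_wpM2l //.
have u := uniq_nbrs (nbrs_irrefl v) aN bN cN.
apply: le_trans (three_clusters p2 tri (uniform_card p) (uniform_green p g01) (uniform_green p g01) u k3).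
by rewrite /X le_eqVlt; apply/orP; left; apply/eqP; ring.
Qed.

End Transitive.

(** * Bridges and the size of Omega p *)

Section Bridges.
Variables (R : realType) (T : finType) (B : {set {set T}}) (o : T).
Implicit Types (w : {set {set T}}) (s x y z u v : T) (A D S : {set T}) (p g k : R).
Hypotheses (gB : is_graph B) (trB : transitive_graph B).

Lemma bexp_edge p b : b \in B -> bexp B p (fun w => (b \in w)%:R) = p.
Proof.
move=> bB; rewrite -(setD1K bB) bexpU1 ?inE ?eqxx //.
rewrite (_ : bexp _ _ _ = 0); last first.
  rewrite -[RHS](bexp_cst (B :\ b) p); apply: eq_bexp => w /subsetP wB.
  by have [/wB|//] := boolP (b \in w); rewrite !inE eqxx.
rewrite mulr0 add0r (_ : bexp _ _ _ = 1) ?mulr1 //.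
by rewrite -[RHS](bexp_cst (B :\ b) p); apply: eq_bexp => w _; rewrite setU11.
Qed.

(** The bond [uv] is occupied and is crossed, from [u] to [v], by every path from
    [s] to [v]. *)
Definition bridge w s u v :=
  [&& [set u; v] \in w, connected_by (w :\ [set u; v]) s u
    & ~~ connected_by (w :\ [set u; v]) s v].

(** The path from [s] to [u] does not visit [v], so it avoids the bond [u'v] as
    well, and with [uv] it would join [s] to [v] off [u'v]. *)
Lemma bridge_unique w s u u' v : u != v -> u' != v ->
  bridge w s u v -> bridge w s u' v -> u = u'.
Proof.
move=> uv u'v /and3P[uvw su nsv] /and3P[u'vw su' nsv']; apply/eqP/negPn/negP => uu'.
suff [_ su2] : connected_by (w :\ [set u; v]) s u /\ connected_by (w :\ [set u'; v]) s u.
  case/negP: nsv'; apply: con_trans su2 (con_edge _); rewrite !inE uvw andbT.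
  by apply: contra_neq uu' => E; apply: (set2_inj (v := v) uv); rewrite setUC E setUC.
apply: (con_ind (P := fun t => connected_by (w :\ [set u; v]) s t /\
   connected_by (w :\ [set u'; v]) s t) _ _ su) => [t t' tt' [st st2]|]; last by split; apply: con_refl.
have st' := con_trans st (con_edge tt'); split=> //.
apply: con_trans st2 (con_edge _); move: tt'; rewrite !inE => /andP[_ ->]; rewrite andbT.
apply/eqP => E; have : v \in [set t; t'] by rewrite E !inE eqxx orbT.
by rewrite !inE => /orP[]/eqP vE; case/negP: nsv; rewrite {2}vE.
Qed.

(** If [u] and [v] are in different clusters the bond [uv] is closed; opening it
    makes it a bridge and multiplies the weight by p / (1 - p), which is at
    least p. *)
Lemma bridge_prob p s u v : 0 <= p <= 1 -> [set u; v] \in B ->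
  p * bexp B p (fun w => (s \in cluster w u)%:R * (v \notin cluster w u)%:R) <=
  bexp B p (fun w => (bridge w s u v)%:R).
Proof.
move=> /andP[p0 p1] uvB; set b := [set u; v] in uvB *.
have p01 : 0 <= p <= 1 by rewrite p0.
pose f w : R := (s \in cluster w u)%:R * (v \notin cluster w u)%:R.
have bw w : w \subset B :\ b -> b \notin w.
  by move=> /subsetP wB; apply/negP => /wB; rewrite !inE eqxx.
have bB' : b \notin B :\ b by rewrite !inE eqxx.
have f0 w : 0 <= f w by rewrite mulr_ge0.
rewrite -(setD1K uvB) !bexpU1 // -/f.
have -> : bexp (B :\ b) p (fun w => f (b |: w)) = 0.
  rewrite -[RHS](bexp_cst (B :\ b) p); apply: eq_bexp => w _.
  by rewrite /f !mem_cluster (con_edge (setU11 b w)) mulr0.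
rewrite mulr0 addr0 -[leLHS]add0r lerD //.
  by rewrite mulr_ge0 ?subr_ge0 ?bexp_ge0.
rewrite ler_wpM2l //; apply: (@le_trans _ _ (bexp (B :\ b) p f)).
  by rewrite ler_piMl ?bexp_ge0 //; lra.
apply: le_bexp => // w /bw bnw; rewrite /f /bridge setU11 /= setU1K // !mem_cluster.
rewrite con_sym -natrM mulnb ler_nat; case: (boolP (connected_by w s u)) => //= su.
have [sv|_] := boolP (connected_by w s v); last exact: leq_b1.
by rewrite (con_trans _ sv) // con_sym.
Qed.

(** The cluster of [o] has chi points on average, and every [s] sends at most one
    last bridge into [o].  The mean number of pairs of a neighbour [u] and a point [s]
    of its cluster with [o] outside that cluster is at least (1 - k) Omega chi, and
    opening the bond from [u] to [o] costs a factor p. *)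
Lemma degree_p_le p k : 0 <= p <= 1 / 2 -> 0 < chi B o p ->
  (forall x y, x != y -> triangle B p x y <= k) ->
  (degree B o)%:R * p * (1 - k) <= 1.
Proof.
move=> p2 chi0 tri.
have p01 : 0 <= p <= 1 by case/andP: p2 => p0 p_half; apply/andP; split; lra.
have [p0 _] := andP p01.
rewrite -(ler_pM2r chi0) mul1r.
have chiS : chi B o p = \sum_s bexp B p (fun w => (connected_by w s o)%:R).
  rewrite chiE -bexp_sum; apply: eq_bexp => w _.
  rewrite -sum1_card natr_sum big_mkcond /=; apply: eq_bigr => s _.
  by rewrite mem_cluster con_sym; case: connected_by.
rewrite [leRHS]chiS; apply: (@le_trans _ _ (\sum_s \sum_(u in nbrs B o) bexp B p (fun w => (bridge w s u o)%:R))).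
  rewrite exchange_big /= -card_nbrs_degree // -sum1_card natr_sum !mulr_suml.
  apply: ler_sum => u uN; rewrite mul1r.
  have uoB : [set u; o] \in B by move: uN; rewrite inE setUC.
  have uo := nbrs_neq gB uN.
  apply: le_trans (ler_sum _ (fun s _ => bridge_prob s p01 uoB)).
  rewrite -mulr_sumr -bexp_sum -mulrA ler_wpM2l //.
  have -> : bexp B p (fun w => \sum_s (s \in cluster w u)%:R * (o \notin cluster w u)%:R)
     = chi B o p - bexp B p (fun w => #|cluster w u|%:R * (o \in cluster w u)%:R).
    rewrite -(mean_card o gB trB p u) -bexpB; apply: eq_bexp => w _.
    have -> : #|cluster w u|%:R = \sum_s (s \in cluster w u)%:R :> R.
      by rewrite -sum1_card natr_sum big_mkcond /=; apply: eq_bigr => s _; case: (s \in _).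
    by rewrite -mulr_suml; case: (o \in _) => /=; ring.
  rewrite mulrBl mul1r lerD2l lerN2 mulrC.
  have [hc mc] := uniform_card o gB trB p.
  apply: le_trans (mean_tripod p2 hc mc u o) _; rewrite ler_wpM2l ?(ltW chi0) //.
  by apply: (le_trans (triangle_ge_pair B u o p01)); apply: tri.
apply: ler_sum => s _; rewrite -bexp_sum; apply: le_bexp => // w _.
have [/existsP[u0 /andP[u0N b0]]|nb] := boolP [exists u, (u \in nbrs B o) && bridge w s u o].
  rewrite (bigD1 u0) //= b0 big1 ?addr0.
    case/and3P: b0 => uw su _; rewrite (con_trans _ (con_edge uw)) //.
    by apply: con_mono su; rewrite subsetDl.
  move=> u /andP[uN uu0]; case: (boolP (bridge _ _ _ _)) => // bu.
  by case/eqP: uu0; apply: (bridge_unique _ _ bu b0); apply: (nbrs_neq gB).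
rewrite big1 // => u uN; case: (boolP (bridge _ _ _ _)) => // bu.
by case/existsP: nb; exists u; rewrite uN.
Qed.

End Bridges.

(** * Pivotal bonds *)

Section Cuts.
Variables (R : realType) (T : finType) (B : {set {set T}}) (o : T).
Implicit Types (w : {set {set T}}) (s x y z u v : T) (A D S : {set T}) (p g k : R).
Hypotheses (gB : is_graph B) (trB : transitive_graph B).

(** Each point of the cluster is reached off [A] or through a first bond into [A],
    which is followed by a disjoint connection. *)
Lemma chi_cut p A : 0 <= p <= 1 / 2 -> o \notin A ->
  chi B o p <= bexp (off B A) p (fun w => #|cluster w o|%:R) +
    p * bexp (off B A) p (fun w =>
      \sum_x \sum_(y in nbrs B x | y \in A) (x \in cluster w o)%:R) * chi B o p.
Proof.
move=> p2 oA.
have p01 : 0 <= p <= 1 by case/andP: p2 => p0 p_half; apply/andP; split; lra.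
have [p0 p1] := andP p01.
pose E1 x := fun K : {set {set T}} => connected_by (off K A) o x.
pose E3 y z := fun K : {set {set T}} => connected_by K y z.
pose E2 x y := fun K : {set {set T}} => [set x; y] \in K.
have step z : bexp B p (fun w => (connected_by w o z)%:R) <=
    bexp (off B A) p (fun w => (connected_by w o z)%:R) +
    \sum_x \sum_(y in nbrs B x | y \in A)
      bexp (off B A) p (fun w => (connected_by w o x)%:R) * p * tau B p y z.
  apply: (@le_trans _ _ (bexp B p (fun w => (connected_by (off w A) o z)%:R +
    \sum_x \sum_(y in nbrs B x | y \in A) (box (E1 x) (box (E2 x y) (E3 y z)) w)%:R))).
    apply: le_bexp => // w wB; case: (boolP (connected_by w o z)) => [oz|_]; last first.
      by rewrite addr_ge0 // sumr_ge0 // => x _; rewrite sumr_ge0.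
    have [->|[x [y [yA xA bx]]]] := box_first_hit oA oz.
      by rewrite lerDl sumr_ge0 // => x _; rewrite sumr_ge0.
    rewrite -[leLHS]add0r lerD // (bigD1 x) //= (bigD1 y) /=; last first.
      rewrite yA andbT inE; apply: (subsetP wB).
      by case/boxP: bx => K [_ _ /boxP[L [/subsetP Lw xyL _]]]; have := Lw _ xyL; rewrite inE => /andP[].
    rewrite bx -addrA lerDl addr_ge0 ?sumr_ge0 // => s _; exact: sumr_ge0.
  rewrite bexpD (bexp_off B p A (fun w => (connected_by w o z)%:R)) lerD2l bexp_sum.
  apply: ler_sum => x _; rewrite bexp_sum; apply: ler_sum => y /andP[yN yA].
  have u1 : upward (E1 x) by move=> K L KL; apply: con_mono; apply: off_mono.
  have u2 : upward (E2 x y) by move=> K L /subsetP KL; apply: KL.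
  have u3 : upward (E3 y z) by apply: upward_con.
  apply: le_trans (bk B p2 u1 (upward_box u2 u3)) _.
  rewrite -(bexp_off B p A (fun w => (connected_by w o x)%:R)) -mulrA ler_wpM2l ?bexp_ge0 //.
  apply: le_trans (bk B p2 u2 u3) _; rewrite tauE ler_wpM2r ?bexp_ge0 //.
  by rewrite bexp_edge //; move: yN; rewrite inE.
have cardS (B' : {set {set T}}) y : bexp B' p (fun w => #|cluster w y|%:R) =
    \sum_z bexp B' p (fun w => (connected_by w y z)%:R).
  by rewrite -bexp_sum; apply: eq_bexp => w _; rewrite card_sum_mem; apply: eq_bigr => z _; rewrite mem_cluster.
rewrite {1}chiE !cardS; apply: (le_trans (ler_sum _ (fun z _ => step z))).
rewrite big_split /= -cardS cardS lerD2l.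
have -> : bexp (off B A) p (fun w => \sum_x \sum_(y in nbrs B x | y \in A) (x \in cluster w o)%:R)
   = \sum_x \sum_(y in nbrs B x | y \in A) bexp (off B A) p (fun w => (connected_by w o x)%:R).
  rewrite bexp_sum; apply: eq_bigr => x _; rewrite bexp_sum; apply: eq_bigr => y _.
  by apply: eq_bexp => w _; rewrite mem_cluster.
rewrite le_eqVlt; apply/orP; left; apply/eqP.
have := mean_card o gB trB p; move: (chi B o p) => X meanX.
rewrite [LHS]exchange_big /= mulr_sumr mulr_suml; apply: eq_bigr => x _.
rewrite [LHS]exchange_big /= mulr_sumr mulr_suml; apply: eq_bigr => y _.
rewrite -mulr_sumr -(meanX y) cardS [p * _]mulrC; congr (_ * _).
by apply: eq_bigr => z _; rewrite tauE.
Qed.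

(** The case where only the root is left off [A]. *)
Lemma chi_le_degree p : 0 <= p <= 1 / 2 ->
  chi B o p <= 1 + (degree B o)%:R * p * chi B o p.
Proof.
move=> p2; have oA : o \notin ~: [set o] by rewrite !inE negbK eqxx.
apply: (le_trans (chi_cut p2 oA)).
have only w x : (x \in cluster (off w (~: [set o])) o) = (x == o).
  rewrite mem_cluster; apply/idP/eqP => [ox|->]; last exact: con_refl.
  apply/eqP/negPn/negP => xo; move: xo (ox); rewrite con_sym => xo.
  by move/(con_off_touch (_ : x \in ~: [set o])); rewrite !inE xo => /(_ isT) E; rewrite E eqxx in xo.
rewrite -!(bexp_off B p (~: [set o])).
have -> : bexp B p (fun w => #|cluster (off w (~: [set o])) o|%:R) = 1.
  rewrite -[RHS](bexp_cst B p); apply: eq_bexp => w _.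
  suff -> : cluster (off w (~: [set o])) o = [set o] by rewrite cards1.
  by apply/setP => x; rewrite only inE.
rewrite lerD2l [p * _]mulrC ler_wpM2r //.
  by rewrite chiE bexp_ge0 //; case/andP: p2 => p0 p_half; apply/andP; split; lra.
have [p0 _] := andP p2; rewrite ler_wpM2r // -[leRHS](bexp_cst B p).
apply: le_bexp => [|w _]; first by case/andP: p2 => _ p_half; apply/andP; split; lra.
rewrite (bigD1 o) //= [X in _ + X]big1 ?addr0; last first.
  by move=> x xo; rewrite big1 // => y _; rewrite only (negPf xo).
rewrite only eqxx -card_nbrs_degree // card_sum_mem big_mkcond [leRHS]big_mkcond /=.
apply: ler_sum => y _; case: (y \in nbrs B o) => //=; case: ifP => //.
Qed.

(** Adding any bond between the cluster of [o] and the hull of [S] connects [o] to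
    [S]. *)
Lemma pivotal_ge w S :
  (o \notin hull w S)%:R * \sum_x \sum_(y in nbrs B x | y \in hull w S) (x \in cluster w o)%:R <=
  \sum_(b in B :\: w) ((hits (cluster (b |: w) o) S)%:R - (hits (cluster w o) S)%:R) :> R.
Proof.
have [oh|oh] := boolP (o \in hull w S).
  rewrite mul0r sumr_ge0 // => b _; rewrite subr_ge0 ler_nat.
  have := @hits_mono _ _ _ S (@cluster_mono _ w (b |: w) o (subsetUr _ _)).
  by case: (hits (cluster w o) S) => // ->.
rewrite mul1r; have -> : hits (cluster w o) S = false by rewrite -mem_hull (negPf oh).
under [leRHS]eq_bigr => b _ do rewrite subr0.
pose Q := [set xy : T * T | [&& [set xy.1; xy.2] \in B, xy.2 \in hull w S & xy.1 \in cluster w o]].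
have memQ x y : ((x, y) \in Q) = [&& [set x; y] \in B, y \in hull w S & x \in cluster w o].
  by rewrite inE.
have -> : \sum_x \sum_(y in nbrs B x | y \in hull w S) (x \in cluster w o)%:R = #|Q|%:R :> R.
  transitivity (\sum_x \sum_y ((x, y) \in Q)%:R : R); last first.
    by rewrite pair_bigA card_sum_mem; apply: eq_bigr => -[x y].
  apply: eq_bigr => x _; rewrite big_mkcond /=; apply: eq_bigr => y _.
  rewrite memQ [y \in nbrs B x]inE; case: (_ \in B) => //=.
  by case: (y \in hull w S).
have CH x : x \in cluster w o -> x \notin hull w S.
  by rewrite mem_cluster => ox; rewrite mem_hull -(cluster_eq ox) -mem_hull.
(* a bond determines its endpoint in the hull, hence its orientation *)
have injQ : {in Q &, injective (fun xy : T * T => [set xy.1; xy.2])}.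
  move=> [x y] [x' y']; rewrite !memQ /= => /and3P[_ yh xC] /and3P[_ y'h x'C] E.
  have xy' : x != y' by apply: contraNneq (CH x xC) => ->.
  have x'y : x' != y by apply: contraNneq (CH x' x'C) => ->.
  have /eqP xx' : x == x'.
    have : x \in [set x'; y'] by rewrite -E set21.
    by rewrite in_set2 (negPf xy') orbF.
  have /eqP yy' : y == y'.
    have : y \in [set x'; y'] by rewrite -E set22.
    by rewrite in_set2 eq_sym (negPf x'y).
  by rewrite xx' yy'.
rewrite -natr_sum ler_nat -(card_in_imset injQ) -sum1_card big_mkcond [leqRHS]big_mkcond /=.
apply: leq_sum => b _; case: ifP => // /imsetP[[x y]]; rewrite memQ /= => /and3P[xyB yh xC] ->.
have xyw : [set x; y] \notin w.
  by apply: contra (CH x xC); rewrite setUC => yx; apply: hull_step yx yh.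
rewrite inE xyw xyB /=; suff -> : hits (cluster ([set x; y] |: w) o) S by [].
move: yh; rewrite mem_hull => /hitsP[s]; rewrite mem_cluster => ys sS.
apply/hitsP; exists s => //; rewrite mem_cluster.
apply: con_trans (con_trans (con_edge (setU11 _ _)) _).
  by move: xC; rewrite mem_cluster; apply: con_mono; apply: subsetUr.
by apply: con_mono ys; apply: subsetUr.
Qed.

Lemma green_prob_ge0 g A : 0 <= g <= 1 -> 0 <= green_prob g A.
Proof. by move=> g01; apply/hitting_ge0/hitting_green. Qed.

Lemma green_add_edge g w s t : 0 <= g <= 1 ->
  s \in cluster w o -> t \notin cluster w o ->
  green_prob g (cluster ([set s; t] |: w) o) - green_prob g (cluster w o) <=
  (1 - g) ^+ #|cluster w o| * green_prob g (cluster w t).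
Proof.
move=> g01 sC tC; have [g0 g1] := andP g01.
have sub : cluster ([set s; t] |: w) o \subset cluster w o :|: cluster w t.
  apply/subsetP => z; rewrite mem_cluster.
  apply: (con_ind (P := fun u => u \in cluster w o :|: cluster w t)); last first.
    by rewrite in_setU mem_cluster con_refl.
  move=> u v; rewrite in_setU1 !in_setU => /orP[/eqP E _|uv].
    have : v \in [set s; t] by rewrite -E set22.
    by rewrite in_set2 => /orP[]/eqP ->; rewrite ?sC // !mem_cluster con_refl orbT.
  rewrite !mem_cluster => /orP[] h; apply/orP; [left|right]; exact: con_trans h (con_edge uv).
apply: (@le_trans _ _ (green_prob g (cluster w o :|: cluster w t) - green_prob g (cluster w o))).
  by rewrite lerD2r; apply: hitting_mono sub; apply: hitting_green.
rewrite /green_prob cardsU.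
have -> : cluster w o :&: cluster w t = set0.
  apply/setP => z; rewrite in_setI in_set0; apply/negP => /andP[]; rewrite !mem_cluster => oz tz.
  by case/negP: tC; rewrite mem_cluster; apply: con_trans oz _; rewrite con_sym.
rewrite cards0 subn0 exprD.
move: ((1 - g) ^+ #|cluster w o|) ((1 - g) ^+ #|cluster w t|) => X Y; lra.
Qed.

Lemma cluster_add_inner w s t : (s \in cluster w o) = (t \in cluster w o) ->
  cluster ([set s; t] |: w) o = cluster w o.
Proof.
move=> st; apply/eqP; rewrite eqEsubset; apply/andP; split; last first.
  by apply: cluster_mono; apply: subsetUr.
apply/subsetP => z; rewrite mem_cluster.
apply: (con_ind (P := fun u => u \in cluster w o)); last by rewrite mem_cluster con_refl.
move=> u v; rewrite in_setU1 => /orP[/eqP E uC|uv]; last first.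
  by rewrite !mem_cluster => h; apply: con_trans h (con_edge uv).
have : u \in [set s; t] by rewrite -E set21.
have : v \in [set s; t] by rewrite -E set22.
rewrite !in_set2 => /orP[]/eqP vE /orP[]/eqP uE; move: uC; rewrite vE uE // ?st //.
Qed.

(** An added bond [xy] only matters when [x] is in the cluster of [o] and [y] is not.
    It then adjoins the cluster of [y], and the gain in [green_prob] is the
    product of the probability that no vertex of the first cluster is green and that
    some vertex of the second one is. *)
Lemma pivotal_le g w : 0 <= g <= 1 ->
  \sum_(b in B :\: w) (green_prob g (cluster (b |: w) o) - green_prob g (cluster w o)) <=
  (1 - g) ^+ #|cluster w o| *
    \sum_(x in cluster w o) \sum_(y in nbrs B x | y \notin cluster w o) green_prob g (cluster w y).
Proof.
move=> g01; have [g0 g1] := andP g01; set C := cluster w o.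
have c0 : 0 <= (1 - g) ^+ #|C| by rewrite exprn_ge0 // subr_ge0.
pose val y := (1 - g) ^+ #|C| * green_prob g (cluster w y).
have val0 y : 0 <= val y by rewrite mulr_ge0 // green_prob_ge0.
apply: (@le_trans _ _ (\sum_(b in B :\: w) \sum_(x in C) \sum_(y in nbrs B x | y \notin C)
    (b == [set x; y])%:R * val y)).
  apply: ler_sum => b; rewrite in_setD => /andP[_ bB].
  have /eqP/cards2P[s [t [_ bE]]] := gB bB.
  have step s' t' : b = [set s'; t'] -> s' \in C -> t' \notin C ->
      green_prob g (cluster (b |: w) o) - green_prob g C <=
      \sum_(x in C) \sum_(y in nbrs B x | y \notin C) (b == [set x; y])%:R * val y.
    move=> bE' sC tC; rewrite bE' in bB *; apply: le_trans (green_add_edge g01 sC tC) _.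
    rewrite (bigD1 s') //= (bigD1 t') /=; last first.
      by rewrite tC andbT inE.
    rewrite eqxx mul1r -addrA lerDl addr_ge0 //.
      by apply: sumr_ge0 => y _; apply: mulr_ge0.
    by do 2! (apply: sumr_ge0 => ? _); apply: mulr_ge0.
  have [sC|sC] := boolP (s \in C); have [tC|tC] := boolP (t \in C).
  - rewrite bE cluster_add_inner ?subrr; last by rewrite -/C sC tC.
    by do 2! (apply: sumr_ge0 => ? _); rewrite mulr_ge0.
  - exact: (step s t bE sC tC).
  - by apply: (step t s); rewrite // bE setUC.
  - rewrite bE cluster_add_inner ?subrr; last by rewrite -/C (negPf sC) (negPf tC).
    by do 2! (apply: sumr_ge0 => ? _); rewrite mulr_ge0.
rewrite exchange_big mulr_sumr /=; apply: ler_sum => x _.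
rewrite exchange_big mulr_sumr /=; apply: ler_sum => y /andP[yN yC].
rewrite -mulr_suml -/(val y) ler_piMl //.
have [h|h] := boolP ([set x; y] \in B :\: w).
  by rewrite (bigD1 [set x; y]) //= eqxx big1 ?addr0 // => b /andP[_ /negPf ->].
by rewrite big1 // => b bB; case: eqP => // bE; rewrite -bE bB in h.
Qed.

End Cuts.

(** * Differential inequalities *)

Section Derivatives.
Variables (R : realType) (T : finType) (B : {set {set T}}) (o : T).
Implicit Types (w : {set {set T}}) (s x y z u v : T) (A D S : {set T}) (p q g k : R).
Hypotheses (gB : is_graph B) (trB : transitive_graph B).

Local Notation chi := (chi B o).
Local Notation M := (magnetization B o).
Local Notation Omega := ((degree B o)%:R : R).

(** The mean cluster size on the event that the cluster has no green vertex. *)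
Definition chi_green p g : R :=
  bexp B p (fun w => #|cluster w o|%:R * (1 - g) ^+ #|cluster w o|).

(** By Russo's formula this is 1 - p times the derivative of M in p. *)
Definition pivotal_mean p g : R :=
  bexp B p (fun w => \sum_(b in B :\: w)
    (green_prob g (cluster (b |: w) o) - green_prob g (cluster w o))).

Lemma magE p g : M p g = bexp B p (fun w => green_prob g (cluster w o)).
Proof. by rewrite magnetizationE. Qed.

Lemma card_cluster_mono : increasing_fun (fun w => #|cluster w o|%:R : R).
Proof. by move=> K L KL; rewrite ler_nat subset_leq_card ?cluster_mono. Qed.

Lemma chi_ge1 p : 0 <= p <= 1 -> 1 <= chi p.
Proof.
move=> p01; rewrite chiE -[leLHS](bexp_cst B p); apply: le_bexp => // w _.
by rewrite ler1n; apply/card_gt0P; exists o; rewrite mem_cluster con_refl.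
Qed.

Lemma chi_le p q : 0 <= p <= q -> q <= 1 -> chi p <= chi q.
Proof. by move=> pq q1; apply: bexp_increasing_p pq q1 card_cluster_mono. Qed.

Lemma mag_le p q g : 0 <= p <= q -> q <= 1 -> 0 <= g <= 1 -> M p g <= M q g.
Proof.
move=> pq q1 g01; rewrite !magE; apply: bexp_increasing_p pq q1 _ => K L KL.
by apply: hitting_mono; [apply: hitting_green | apply: cluster_mono].
Qed.

Lemma mag_ge0 p g : 0 <= p <= 1 -> 0 <= g <= 1 -> 0 <= M p g.
Proof. by move=> p01 g01; rewrite magE bexp_ge0 // => w _; apply: green_prob_ge0. Qed.

Lemma mag_le1 p g : 0 <= p <= 1 -> 0 <= g <= 1 -> M p g <= 1.
Proof.
move=> p01 /andP[g0 g1]; rewrite magE -[leRHS](bexp_cst B p); apply: le_bexp => // w _.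
by rewrite /green_prob gerBl exprn_ge0 // subr_ge0.
Qed.

Lemma mag_le_chi p g : 0 <= p <= 1 -> 0 <= g <= 1 -> M p g <= g * chi p.
Proof.
move=> p01 g01; rewrite magE chiE -bexpZ; apply: le_bexp => // w _.
exact: one_sub_exp_le.
Qed.

Lemma chi_green_le p g : 0 <= p <= 1 -> 0 <= g <= 1 -> g * chi_green p g <= M p g.
Proof.
by move=> p01 g01; rewrite magE -bexpZ; apply: le_bexp => // w _; apply: mul_exp_le.
Qed.

Lemma chi_green_ge0 p g : 0 <= p <= 1 -> 0 <= g <= 1 -> 0 <= chi_green p g.
Proof.
move=> p01 /andP[g0 g1]; apply: bexp_ge0 => // w _.
by rewrite mulr_ge0 // exprn_ge0 // subr_ge0.
Qed.

(** The Aizenman--Barsky inequality (1-p) dM/dp <= Omega M E[|C|; no green]: off the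
    explored cluster, each of the at most Omega |C| boundary bonds leads to a
    green vertex with probability at most M. *)
Lemma pivotal_mean_le p g : 0 <= p <= 1 / 2 -> 0 <= g <= 1 ->
  pivotal_mean p g <= Omega * M p g * chi_green p g.
Proof.
move=> p2 g01; have [g0 g1] := andP g01.
have p01 : 0 <= p <= 1 by case/andP: p2 => p0 p_half; apply/andP; split; lra.
pose H A w := (1 - g) ^+ #|A| *
  \sum_(x in A) \sum_(y in nbrs B x | y \notin A) green_prob g (cluster w y).
apply: (@le_trans _ _ (bexp B p (fun w => H (cluster w o) (off w (cluster w o))))).
  apply: le_bexp => // w _; apply: le_trans (pivotal_le o gB w g01) _.
  rewrite /H le_eqVlt; apply/orP; left; apply/eqP; congr (_ * _).
  apply: eq_bigr => x xC; apply: eq_bigr => y /andP[_ yC].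
  by rewrite cluster_off_cluster.
rewrite explore_cluster /chi_green -bexpZ; apply: le_bexp => // w _.
set A := cluster w o; rewrite /H bexpZ.
have c0 : 0 <= (1 - g) ^+ #|A| by rewrite exprn_ge0 // subr_ge0.
rewrite [leRHS]mulrA [leRHS]mulrC ler_wpM2l // bexp_sum.
have M0 := mag_ge0 p01 g01.
apply: (@le_trans _ _ (\sum_(x in A) Omega * M p g)); last first.
  by rewrite sumr_const -[leLHS]mulr_natr.
apply: ler_sum => x xA; rewrite bexp_sum.
apply: (@le_trans _ _ (\sum_(y in nbrs B x) M p g)); last first.
  by rewrite sumr_const (card_nbrs o) // -[leLHS]mulr_natl.
rewrite big_mkcondr /=; apply: ler_sum => y _; case: ifP => // _.
have [hg mg] := uniform_green o gB trB p g01.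
exact: mean_off_le.
Qed.

(** Explore all clusters that contain a green vertex, and suppose that they miss [o].
    By [chi_cut] the mean number of boundary bonds joining the cluster of [o]
    to the explored set is at least (1 - E|C| / chi) / p, where C is the cluster of [o]
    off that set. *)
Lemma pivotal_mean_ge p g : 0 <= p <= 1 / 2 -> 0 <= g <= 1 ->
  1 - M p g - chi_green p g / chi p <= p * pivotal_mean p g.
Proof.
move=> p2 g01; have [g0 g1] := andP g01.
have p01 : 0 <= p <= 1 by case/andP: p2 => p0 p_half; apply/andP; split; lra.
have [p0 p1] := andP p01.
have chi0 : 0 < chi p by apply: lt_le_trans (chi_ge1 p01).
pose F S w : R := (o \notin hull w S)%:R * (1 - #|cluster w o|%:R / chi p).
have -> : 1 - M p g - chi_green p g / chi p = bexp setT g (fun S => bexp B p (F S)).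
  rewrite -bexp_exchange magE /chi_green -bexpZr -{1}[1](bexp_cst B p) -!bexpB.
  apply: eq_bexp => w _; rewrite /F bexpZr.
  have -> : bexp setT g (fun S => (o \notin hull w S)%:R) = (1 - g) ^+ #|cluster w o|.
    by rewrite -prob_misses; apply: eq_bexp => S _; rewrite mem_hull.
  rewrite /green_prob; move: ((1 - g) ^+ #|cluster w o|) => X; ring.
have -> : pivotal_mean p g = bexp setT g (fun S => bexp B p (fun w =>
    \sum_(b in B :\: w) ((hits (cluster (b |: w) o) S)%:R - (hits (cluster w o) S)%:R))).
  rewrite -bexp_exchange; apply: eq_bexp => w _; rewrite bexp_sum; apply: eq_bigr => b _.
  by rewrite bexpB !green_probE.
rewrite -bexpZ; apply: le_bexp => // S _.
pose H A w : R := (o \notin A)%:R *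
  \sum_x \sum_(y in nbrs B x | y \in A) (x \in cluster w o)%:R.
apply: (@le_trans _ _ (p * bexp B p (fun w => H (hull w S) (off w (hull w S))))); last first.
  rewrite ler_wpM2l //; apply: le_bexp => // w _.
  apply: le_trans (pivotal_ge R B o w S); rewrite /H.
  by have [oh|oh] := boolP (o \in hull w S); rewrite ?mul0r // cluster_off_hull.
rewrite explore -bexpZ.
pose H' A w : R := (o \notin A)%:R * (1 - #|cluster w o|%:R / chi p).
have -> : bexp B p (F S) = bexp B p (fun w => H' (hull w S) (off w (hull w S))).
  apply: eq_bexp => w _; rewrite /F /H'.
  by have [oh|oh] := boolP (o \in hull w S); rewrite ?mul0r // cluster_off_hull.
rewrite explore; apply: le_bexp => // w _; rewrite /H /H' !bexpZ mulrCA.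
have [oh|oh] := boolP (o \in hull w S); rewrite ?mul0r // !mul1r.
rewrite bexpB bexp_cst bexpZr.
have cut := chi_cut gB trB p2 oh.
rewrite -(ler_pM2r chi0) mulrBl mul1r divfK ?gt_eqF //; lra.
Qed.

Lemma mag_poly_deriv p g :
  (1 - p) * (bexp B 'X (fun w => (green_prob g (cluster w o))%:P))^`().[p] = pivotal_mean p g.
Proof.
rewrite russo [X in _ + _ * X](_ : _ = 0) ?mulr0 ?addr0.
  by apply: eq_bexp => w _; apply: eq_bigr => b _; rewrite !hornerC.
by rewrite -[RHS](bexp_cst B p); apply: eq_bexp => w _; rewrite derivC horner0.
Qed.

Lemma mag_poly_horner p g :
  (bexp B 'X (fun w => (green_prob g (cluster w o))%:P)).[p] = M p g.
Proof. by rewrite horner_bexp magE; apply: eq_bexp => w _; rewrite hornerC. Qed.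

(** As long as M is below e / 6, the inequality of [pivotal_mean_ge] gives
    p dM/dp >= 2/3, because E[|C|; no green] <= M / g.  Integrate from p to p'. *)
Lemma supercritical p p' g e : 0 < p <= p' -> p' <= 1 / 2 -> 0 < g <= 1 -> 0 < e <= 1 ->
  e <= g * chi p -> M p' g < e / 6 -> (2 / 3) * (p' - p) <= p' * M p' g.
Proof.
move=> /andP[p0 pp'] p'2 /andP[g0 g1] /andP[e0 e1] gchi Msmall.
have g01 : 0 <= g <= 1 by rewrite ltW.
have p'01 : 0 <= p' <= 1 by apply/andP; split; lra.
have p'0 : 0 < p' by lra.
rewrite -mag_poly_horner; set P := bexp B 'X _.
have : (2 / 3) / p' * (p' - p) <= P.[p'] - P.[p].
  apply: le_poly_deriv => // x /andP[px xp'].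
  have x2 : 0 <= x <= 1 / 2 by apply/andP; split; lra.
  have x01 : 0 <= x <= 1 by apply/andP; split; lra.
  have D := mag_poly_deriv x g; rewrite -/P in D.
  have := pivotal_mean_ge x2 g01; rewrite -D.
  have Mx : M x g < e / 6.
    by apply: le_lt_trans Msmall; apply: mag_le => //; [apply/andP; split; lra | lra].
  have cx : e <= g * chi x.
    apply: (le_trans gchi); rewrite ler_wpM2l ?(ltW g0) // chi_le //; [apply/andP; split; lra|lra].
  have cx0 : 0 < chi x by apply: lt_le_trans (chi_ge1 x01).
  have cg : chi_green x g / chi x <= 1 / 6.
    rewrite ler_pdivrMr //; have := chi_green_le x01 g01 => h.
    rewrite -(ler_pM2l g0); lra.
  move=> h; rewrite ler_pdivrMr //.
  have h1 : 2 / 3 <= x * ((1 - x) * P^`().[x]) by lra.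
  have D0 : 0 <= P^`().[x].
    rewrite -(pmulr_rge0 _ (_ : 0 < x * (1 - x))) -?mulrA; last by rewrite mulr_gt0; lra.
    by apply: le_trans h1; lra.
  apply: (le_trans h1); rewrite mulrA [leLHS]mulrC ler_wpM2l //; nra.
have M0 : 0 <= P.[p].
  by rewrite mag_poly_horner mag_ge0 //; apply/andP; split; lra.
move=> h; have : 2 / 3 / p' * (p' - p) <= P.[p'] by lra.
by rewrite mulrAC ler_pdivrMr // mulrC [_ * p']mulrC.
Qed.

(** Along the line g(x) = g + K m (p' - x), with m = M(p', g), the Aizenman--Barsky
    inequality shows that M(x, g(x)) is nonincreasing in x wherever it lies below m.
    As it equals m at x = p', it cannot lie below m at x = p. *)
Lemma mag_extrapolate p p' g K : 0 <= p <= p' -> p' <= 1 / 2 -> 0 <= g <= 1 -> 0 <= K ->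
  Omega <= K * (1 - p') -> g + K * M p' g * (p' - p) <= 1 ->
  M p' g <= M p (g + K * M p' g * (p' - p)).
Proof.
move=> /andP[p0 pp'] p'2 g01 K0 OK; set m := M p' g => g1'.
have [g0 g1] := andP g01.
have p'01 : 0 <= p' <= 1 by apply/andP; split; lra.
have m0 : 0 <= m by apply: mag_ge0.
have Km0 : 0 <= K * m by rewrite mulr_ge0.
pose q : {poly R} := (1 - g - K * m * p')%:P + (K * m)%:P * 'X.
have qE (x : R) : q.[x] = 1 - (g + K * m * (p' - x)).
  by rewrite /q hornerD hornerC hornerM hornerC hornerX; ring.
have qd : q^`() = (K * m)%:P.
  by rewrite /q derivD derivC add0r derivM derivC mul0r add0r derivX mulr1.
pose F := bexp B 'X (fun w => 1 - q ^+ #|cluster w o|).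
have FE (x : R) : F.[x] = M x (g + K * m * (p' - x)).
  rewrite /F horner_bexp magE; apply: eq_bexp => w _.
  by rewrite hornerD hornerN horner_exp qE -polyC1 hornerC.
have dF (x : R) : (1 - x) * F^`().[x] = pivotal_mean x (g + K * m * (p' - x)) -
    (1 - x) * (K * m) * bexp B x (fun w => #|cluster w o|%:R * q.[x] ^+ #|cluster w o|.-1).
  rewrite russo; congr (_ + _).
    apply: eq_bexp => w _; apply: eq_bigr => b _.
    by rewrite !hornerD !hornerN !horner_exp qE -polyC1 !hornerC.
  rewrite -mulrA -mulrN; congr (_ * _); rewrite -bexpZ -bexpN; apply: eq_bexp => w _.
  rewrite derivB -polyC1 derivC sub0r hornerN deriv_exp qd hornerMn hornerM hornerC horner_exp.
  by rewrite -mulr_natl mulrCA.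
have : (m%:P - F).[p] <= 0.
  apply: (@poly_barrier _ _ p p') => //; last first.
    by rewrite hornerD hornerN hornerC FE subrr mulr0 addr0 subrr.
  move=> x /andP[px xp'].
  rewrite derivB derivC sub0r !hornerN hornerD hornerN hornerC FE subr_gt0 => Mx.
  rewrite oppr_ge0.
  have x2 : 0 <= x <= 1 / 2 by apply/andP; split; lra.
  have x01 : 0 <= x <= 1 by apply/andP; split; lra.
  have gx01 : 0 <= g + K * m * (p' - x) <= 1.
    have h1 : K * m * (p' - x) <= K * m * (p' - p) by rewrite ler_wpM2l //; lra.
    have h2 : 0 <= K * m * (p' - x) by rewrite mulr_ge0 // subr_ge0.
    by apply/andP; split; lra.
  have x1 : 0 < 1 - x by lra.
  rewrite -(pmulr_rle0 _ x1) dF.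
  have := pivotal_mean_le x2 gx01.
  have cg0 := chi_green_ge0 x01 gx01.
  have cgle : chi_green x (g + K * m * (p' - x)) <=
      bexp B x (fun w => #|cluster w o|%:R * q.[x] ^+ #|cluster w o|.-1).
    apply: le_bexp => // w _; rewrite ler_wpM2l // -qE.
    have n0 : (0 < #|cluster w o|)%N by apply/card_gt0P; exists o; rewrite mem_cluster con_refl.
    rewrite -{1}(prednK n0) exprS ler_piMl //.
      by rewrite exprn_ge0 // qE; case/andP: gx01; lra.
    by rewrite qE; case/andP: gx01; lra.
  move: Mx cg0 cgle; set gx := g + K * m * (p' - x); move: (M x gx) (chi_green x gx) (bexp _ _ _).
  move=> Mx cg E Mlt cg0 cgE piv.
  have h1 : Omega * Mx * cg <= Omega * m * cg.
    by rewrite ler_wpM2r // ler_wpM2l // ltW.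
  have h2 : Omega * (m * cg) <= K * (1 - x) * (m * cg).
    by rewrite ler_wpM2r ?mulr_ge0 // (le_trans OK) // ler_wpM2l //; lra.
  have h3 : (1 - x) * (K * m) * cg <= (1 - x) * (K * m) * E.
    by rewrite ler_wpM2l // mulr_ge0 // ltW.
  lra.
by rewrite hornerD hornerN hornerC FE subr_le0.
Qed.

End Derivatives.

(** * The critical threshold and the scaling window *)

Lemma square_bound (R : realFieldType) (C k X Y g : R) : 0 < X -> 0 <= Y ->
  1 / 6 <= C * k -> C * (X * Y ^+ 2 * k) <= 2 * (g * X - Y) -> Y ^+ 2 <= 12 * g.
Proof.
move=> X0 Y0 Ck h; rewrite -(ler_pM2l X0).
have : 1 / 6 * (X * Y ^+ 2) <= C * k * (X * Y ^+ 2).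
  by rewrite ler_wpM2r // mulr_ge0 ?sqr_ge0 // ltW.
lra.
Qed.

Lemma third_le (R : realFieldType) (g X Y : R) : 0 <= g -> 0 <= X -> g * X ^+ 2 <= 1 ->
  g * X - g ^+ 2 * X ^+ 3 / 2 <= Y -> 3^-1 * (g * X) <= Y.
Proof.
move=> g0 X0 gX; have gX0 : 0 <= g * X by rewrite mulr_ge0.
have : g * X * (g * X ^+ 2) <= g * X * 1 by rewrite ler_wpM2l.
lra.
Qed.

Section Main.
Variables (R : realType) (T : finType) (B : {set {set T}}) (o : T).
Implicit Types (w : {set {set T}}) (x y z u v : T) (p q g : R).
Hypotheses (gB : is_graph B) (trB : transitive_graph B).

Local Notation chi := (chi B o).
Local Notation M := (magnetization B o).
Local Notation Omega := ((degree B o)%:R : R).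

(** The tree-graph bound for three points. *)
Lemma second_moment p : 0 <= p <= 1 / 2 ->
  bexp B p (fun w => #|cluster w o|%:R ^+ 2) <= chi p ^+ 3.
Proof.
move=> p2; have p01 : 0 <= p <= 1 by case/andP: p2 => p0 ph; apply/andP; split; lra.
have [hc mc] := uniform_card o gB trB p.
have sumtau x : \sum_y tau B p x y = chi p.
  rewrite -(mc x); under eq_bigr => y _ do rewrite tauE.
  by rewrite -bexp_sum; apply: eq_bexp => w _; rewrite card_sum_mem; apply: eq_bigr => y _; rewrite mem_cluster.
have -> : bexp B p (fun w => #|cluster w o|%:R ^+ 2) =
    \sum_y bexp B p (fun w => #|cluster w o|%:R * (y \in cluster w o)%:R).
  by rewrite -bexp_sum; apply: eq_bexp => w _; rewrite -mulr_sumr -card_sum_mem expr2.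
apply: le_trans (ler_sum _ (fun y _ => mean_tripod p2 hc mc o y)) _.
rewrite -mulr_sumr exchange_big /=.
under eq_bigr => v _ do rewrite -mulr_sumr sumtau.
by rewrite -mulr_suml sumtau -expr2 -exprS.
Qed.

Lemma mag_ge_quadratic p g : 0 <= p <= 1 / 2 -> 0 <= g <= 1 ->
  g * chi p - g ^+ 2 * chi p ^+ 3 / 2 <= M p g.
Proof.
move=> p2 g01; have p01 : 0 <= p <= 1 by case/andP: p2 => p0 ph; apply/andP; split; lra.
apply: (@le_trans _ _ (g * chi p - g ^+ 2 / 2 * bexp B p (fun w => #|cluster w o|%:R ^+ 2))).
  have := second_moment p2; have : 0 <= g ^+ 2 / 2 by rewrite divr_ge0 ?sqr_ge0.
  by move=> /ler_wpM2l/[apply]; lra.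
rewrite chiE magE -!bexpZ -bexpB; apply: le_bexp => // w _.
have := exp_le_quadratic #|cluster w o| g01; rewrite /green_prob.
move: ((1 - g) ^+ _) (_%:R) => X N; lra.
Qed.

(** chi is a polynomial in p with value 1 at p = 0. *)
Lemma chi_ivt c : 1 <= c -> forall q, 0 <= q -> c <= chi q ->
  exists2 p, 0 <= p <= q & chi p = c.
Proof.
move=> c1 q q0 cq; pose P : {poly R} := bexp B 'X (fun w => #|cluster w o|%:R%:P) - c%:P.
have PE p : P.[p] = chi p - c.
  by rewrite /P hornerD hornerN hornerC horner_bexp chiE; congr (_ - _); apply: eq_bexp => w _; rewrite hornerC.
have chi0 : chi (0 : R) = 1.
  rewrite chiE bexp_p0; suff -> : cluster set0 o = [set o] by rewrite cards1.
  apply/setP => x; rewrite mem_cluster inE; apply/idP/eqP => [|->]; last exact: con_refl.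
  by apply: (con_ind (P := fun u => u = o)) => // u v; rewrite inE.
have [|p p0q] := @Num.Theory.poly_ivt _ P 0 q q0.
  by rewrite !PE chi0 subr_le0 subr_ge0 c1.
by rewrite rootE PE subr_eq0 => /eqP; exists p.
Qed.

Lemma critical_thresholdP lam : connected_graph B ->
  1 < lam * cbrtV R T < #|T|%:R ->
  0 <= critical_threshold B o lam <= 1 /\
  chi (critical_threshold B o lam) = lam * cbrtV R T.
Proof.
move=> cB /andP[c1 cV].
have chi1 : chi (1 : R) = #|T|%:R.
  rewrite chiE bexp_p1; suff -> : cluster B o = setT by rewrite cardsT.
  by apply/setP => x; rewrite mem_cluster inE; apply: cB.
have [|p p01 chip] := @chi_ivt (lam * cbrtV R T) (ltW c1) 1 ler01.
  by rewrite chi1 ltW.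
by apply: (@xgetPex _ 0 [set p : R | 0 <= p <= 1 /\ chi p = lam * cbrtV R T]%classic); exists p.
Qed.

Section Critical.
Variable pc : R.
Hypotheses (pc01 : 0 <= pc <= 1) (chi_pc : 100 <= chi pc).
Hypothesis tri : forall x y, x != y -> triangle B pc x y <= 1 / 100.
Hypotheses (cB : connected_graph B) (T1 : (1 < #|T|)%N).

Lemma chi_pc_gt0 : 0 < chi pc.
Proof. by apply: lt_le_trans chi_pc; rewrite ltr0n. Qed.

(** The triangle diagram between two neighbours is at least their connection
    probability, hence at least p. *)
Lemma pc_le : pc <= 1 / 100.
Proof.
have [y yN] : exists y, y \in nbrs B o.
  apply/existsP; apply: contraTT T1 => /existsPn noN; rewrite -leqNgt.
  suff -> : #|T| = #|[set o]| by rewrite cards1.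
  rewrite -cardsT; congr #|pred_of_set _|; apply/setP => x; rewrite !inE.
  apply/esym/eqP; apply: (con_ind (P := fun u => u = o) _ _ (cB o x)) => // u v uv uo.
  by have := noN v; rewrite inE -uo uv.
have oy : o != y by rewrite eq_sym (nbrs_neq gB yN).
apply: le_trans (tri oy); apply: le_trans (triangle_ge_tau B o y pc01).
rewrite tauE -{1}(bexp_edge pc (_ : [set o; y] \in B)); last by move: yN; rewrite inE.
apply: le_bexp => // w _; have [h|//] := boolP ([set o; y] \in w).
by rewrite (con_edge h).
Qed.

Let pc2 : 0 <= pc <= 1 / 2.
Proof. by have := pc_le; case/andP: pc01 => h _ h2; apply/andP; split; lra. Qed.

Lemma degree_pc_ge : 99 / 100 <= Omega * pc.
Proof.
have cut := chi_le_degree o gB trB pc2.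
have h := chi_pc_gt0.
rewrite -(ler_pM2r h).
move: (chi pc) chi_pc cut => X; lra.
Qed.

Lemma degree_pc_le : Omega * pc * (99 / 100) <= 1.
Proof.
have h := chi_pc_gt0.
by have := degree_p_le gB trB pc2 h tri; lra.
Qed.

Lemma pc_gt0 : 0 < pc.
Proof.
rewrite lt_neqAle; case/andP: pc01 => -> _; rewrite andbT; apply/eqP => p0.
by have := degree_pc_ge; rewrite -p0; lra.
Qed.

Lemma degree_ge : 99 <= Omega.
Proof.
have := degree_pc_ge; have := pc_le; have : 0 <= Omega by [].
move: Omega => W W0 h1 h2.
have : W * pc <= W * (1 / 100) by rewrite ler_wpM2l.
lra.
Qed.

(** Bernoulli's inequality for the full exponent only gives 1 - Omega pc, which
    is about 0.  Applied to half of the exponent it gives about 1/2, whose square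
    is enough. *)
Lemma exp_degree_ge : 23 / 100 <= (1 - pc) ^+ (degree B o - 3).
Proof.
have [p0 p1] := andP pc01; have pc1 := pc_le.
have q01 : 0 <= 1 - pc <= 1 by apply/andP; split; lra.
apply: (@le_trans _ _ ((1 - pc) ^+ degree B o)); last first.
  by rewrite ler_wiXn2l ?leq_subr //; case/andP: q01.
have xle := degree_pc_le.
rewrite -(odd_double_half (degree B o)) exprD -muln2 exprM.
set h := (degree B o)./2.
have hle : h%:R * pc <= 51 / 100.
  have : 2 * h%:R <= Omega.
    by rewrite -natrM ler_nat mul2n -[leqRHS](odd_double_half (degree B o)) leq_addl.
  move: (h%:R : R) (Omega) xle => H W xle HW.
  have : 2 * H * pc <= W * pc by rewrite ler_wpM2r.
  lra.
have oge : 99 / 100 <= (1 - pc) ^+ odd (degree B o).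
  by case: (odd _); rewrite ?expr1 ?expr0; lra.
have hge : 49 / 100 <= (1 - pc) ^+ h.
  have := one_sub_exp_le h pc01.
  by clear oge; move: ((1 - pc) ^+ h) (h%:R : R) hle => X H hle; lra.
move: ((1 - pc) ^+ h) ((1 - pc) ^+ odd _) hge oge => Y X hge oge.
have hY : (49 / 100) * (49 / 100) <= Y * Y by apply: ler_pM; lra.
have : (99 / 100) * (24 / 100) <= X * (Y * Y) by apply: ler_pM; lra.
rewrite expr2; lra.
Qed.

(** The factor in [branch_bound] is about (1/2) (1/4), from
    Omega pc close to 1 and [exp_degree_ge]; it exceeds 1/12 with room for the
    errors. *)
Lemma mag_critical g : 0 <= g <= 1 -> M pc g ^+ 2 <= 12 * g.
Proof.
move=> g01; have [p0 p1] := andP pc01; have pc1 := pc_le.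
have k0 : (0 : R) <= 1 / 100 by rewrite divr_ge0.
have k1 : (1 / 100 : R) <= 1 / 3 by lra.
have k3 : 0 <= (1 / 100 : R) <= 1 / 3 by rewrite k0.
have chi0 := chi_pc_gt0.
have M0 := mag_ge0 B o pc01 g01.
have D99 := degree_ge.
have nat1 : ((degree B o).-1)%:R = Omega - 1.
  rewrite -subn1 natrB //; rewrite -(ler_nat R); lra.
have nat2 : ((degree B o).-2)%:R = Omega - 2.
  rewrite -subn2 natrB // -(ler_nat R); lra.
have xge := degree_pc_ge; have ege := exp_degree_ge.
have cge : 1 / 6 <= Omega * (Omega - 1) * (Omega - 2) *
    (pc ^+ 3 * (1 - pc) ^+ (degree B o - 3)) * (1 - 6 * (1 / 100)).
  move: ((1 - pc) ^+ (degree B o - 3)) (Omega) ege xge D99 {nat1 nat2} => E W ege xge D99.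
  have -> : W * (W - 1) * (W - 2) * (pc ^+ 3 * E) * (1 - 6 * (1 / 100)) =
     (W * pc) * ((W - 1) * pc) * ((W - 2) * pc) * E * (94 / 100) by field.
  have h1 : (99 / 100) * (98 / 100) <= (W * pc) * ((W - 1) * pc) by apply: ler_pM; lra.
  have h2 : (99 / 100) * (98 / 100) * (97 / 100) <= (W * pc) * ((W - 1) * pc) * ((W - 2) * pc).
    by apply: ler_pM => //; lra.
  have h3 : (99 / 100) * (98 / 100) * (97 / 100) * (23 / 100) <=
      (W * pc) * ((W - 1) * pc) * ((W - 2) * pc) * E by apply: ler_pM => //; lra.
  lra.
have := branch_bound o gB trB pc2 g01 k3 tri; rewrite !natrM nat1 nat2.
move=> bb; exact: (square_bound chi0 M0 cge bb).
Qed.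

Lemma mag_upper p g : 0 <= g <= 1 -> 0 <= p <= pc -> M p g <= Num.sqrt (12 * g).
Proof.
move=> g01 ppc; have [g0 g1] := andP g01; have [p0 p1] := andP pc01.
apply: (@le_trans _ _ (M pc g)); first exact: mag_le.
rewrite -(ler_pXn2r (n := 2)) ?nnegrE ?sqrtr_ge0 ?mag_ge0 // sqr_sqrtr ?mulr_ge0 //.
exact: mag_critical.
Qed.

(** If g chi^2 <= 1, the second moment suffices.  Otherwise go down to the density p'
    at which g chi(p')^2 = 1 and use that M increases with the density. *)
Lemma mag_lower p g : 0 <= g <= 1 -> 0 <= p <= pc ->
  3^-1 * Num.min (Num.sqrt g) (g * chi p) <= M p g.
Proof.
move=> g01 /andP[p0 ppc]; have [g0 g1] := andP g01; have [_ pc1] := andP pc01.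
have [_ pch] := andP pc2.
have p2 : 0 <= p <= 1 / 2 by apply/andP; split; lra.
have p01 : 0 <= p <= 1 by apply/andP; split; lra.
have chi1 := chi_ge1 B o p01.
have M0 := mag_ge0 B o p01 g01.
have [small|large] := lerP (g * chi p ^+ 2) 1.
  apply: (@le_trans _ _ (3^-1 * (g * chi p))).
    by rewrite ler_wpM2l ?invr_ge0 // ge_min lexx orbT.
  by apply: (third_le g0 _ small (mag_ge_quadratic p2 g01)); apply: le_trans chi1.
have g_gt0 : 0 < g.
  by rewrite lt_neqAle g0 andbT; apply: contraTneq large => <-; rewrite mul0r -leNgt.
set s := Num.sqrt g; have s0 : 0 < s by rewrite sqrtr_gt0.
have sg : s ^+ 2 = g by rewrite sqr_sqrtr.
have s1 : s <= 1 by rewrite -(ler_pXn2r (n := 2)) ?nnegrE ?(ltW s0) // sg expr1n.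
have sV1 : 1 <= s^-1 by rewrite invf_ge1.
have sVchi : s^-1 <= chi p.
  rewrite -(ler_pXn2r (n := 2)) ?nnegrE ?invr_ge0 ?(ltW s0) //; last by lra.
  by rewrite exprVn sg -div1r ler_pdivrMr // mulrC ltW.
have [p' /andP[p'0 p'p] chip'] := chi_ivt sV1 p0 sVchi.
have p'2 : 0 <= p' <= 1 / 2 by apply/andP; split; lra.
apply: (@le_trans _ _ (M p' g)); last first.
  by apply: mag_le => //; [rewrite p'0 | lra].
apply: (@le_trans _ _ (3^-1 * s)); first by rewrite ler_wpM2l ?invr_ge0 // ge_min lexx.
apply: le_trans (mag_ge_quadratic p'2 g01); rewrite chip' -sg.
have -> : s ^+ 2 * s^-1 - (s ^+ 2) ^+ 2 * s^-1 ^+ 3 / 2 = s / 2.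
  by field; rewrite gt_eqF.
lra.
Qed.

(** With m = M(p, g), extrapolation down to pc and the bound at pc give
    m^2 <= 12 g + 13 e m, the constant 13 being 12 times the factor 13/12 that covers
    1 / (1 - p). *)
Lemma mag_window p g e : 0 <= g <= 1 -> p = pc + Omega^-1 * e -> p <= 1 -> 0 <= e ->
  M p g <= Num.sqrt (12 * g) + 13 * e.
Proof.
move=> g01 pE p1 e0; have [g0 g1] := andP g01; have D99 := degree_ge; have pch := pc_le.
have [p0 _] := andP pc01.
have D0 : 0 < Omega by lra.
have eD : 0 <= Omega^-1 * e by rewrite mulr_ge0 ?invr_ge0 // ltW.
have p01 : 0 <= p <= 1 by apply/andP; split; lra.
have m0 := mag_ge0 B o p01 g01; have m1 := mag_le1 B o p01 g01.
set s := Num.sqrt (12 * g); have s0 : 0 <= s by apply: sqrtr_ge0.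
have sg : s ^+ 2 = 12 * g by rewrite sqr_sqrtr // mulr_ge0.
have [e13|e13] := lerP 1 (13 * e); first lra.
have [s1|s1] := lerP 1 s; first lra.
have g12 : g < 1 / 12.
  have : s ^+ 2 < 1 by rewrite expr_lt1.
  lra.
have eDs : Omega^-1 * e <= 1 / 99.
  have : Omega^-1 <= 99^-1 by rewrite lef_pV2 ?posrE //; lra.
  have : 0 <= Omega^-1 by rewrite invr_ge0 ltW.
  by move: Omega^-1 => W W0 W99; nra.
have m13 : M p g * e <= e by rewrite ler_piMl.
have me0 : 0 <= M p g * e by rewrite mulr_ge0.
pose K := Omega * (13 / 12).
have KE : g + K * M p g * (p - pc) = g + 13 / 12 * (M p g * e).
  by rewrite pE /K; field; rewrite gt_eqF.
have g'1 : 0 <= g + 13 / 12 * (M p g * e) <= 1 by apply/andP; split; lra.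
have := @mag_extrapolate R T B o gB trB pc p g K.
rewrite KE => ext; have {ext} mle : M p g <= M pc (g + 13 / 12 * (M p g * e)).
  apply: ext => //; try by [case/andP: g'1].
  - by apply/andP; split; lra.
  - by lra.
  - by rewrite /K; lra.
  - by rewrite /K; nra.
have := mag_critical g'1.
have : M p g ^+ 2 <= M pc (g + 13 / 12 * (M p g * e)) ^+ 2.
  by rewrite lerXn2r ?nnegrE ?mag_ge0.
move: (M p g) m0 sg => m m0 sg h1 h2; have {h1 h2} : m ^+ 2 <= s ^+ 2 + 13 * e * m by lra.
move=> hm; rewrite leNgt; apply/negP => lt_m.
have : 0 < (m - s - 13 * e) * m by rewrite mulr_gt0; lra.
have : 0 <= s * (m - s) by rewrite mulr_ge0 //; lra.
lra.
Qed.

Lemma mag_supercritical p g e : 0 <= g <= 1 -> 0 <= e <= 1 -> p = pc + Omega^-1 * e ->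
  e <= g * chi pc -> e / 6 <= M p g.
Proof.
move=> g01 /andP[e0 e1] pE gchi; have [g0 g1] := andP g01.
have D99 := degree_ge; have pch := pc_le; have xle := degree_pc_le; have p0 := pc_gt0.
have D0 : 0 < Omega by lra.
have eD : 0 <= Omega^-1 * e by rewrite mulr_ge0 ?invr_ge0 // ltW.
have eDs : Omega^-1 * e <= 1 / 99.
  have : Omega^-1 <= 99^-1 by rewrite lef_pV2 ?posrE //; lra.
  have : 0 <= Omega^-1 by rewrite invr_ge0 ltW.
  by move: Omega^-1 => W W0 W99; nra.
have p01 : 0 <= p <= 1 by apply/andP; split; lra.
have M0 := mag_ge0 B o p01 g01.
have [e_le0|e_gt0] := lerP e 0; first lra.
have g_gt0 : 0 < g.
  by rewrite lt_neqAle g0 andbT; apply: contraTneq gchi => <-; rewrite mul0r -ltNge.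
rewrite leNgt; apply/negP => Msmall.
have := @supercritical R T B o gB trB pc p g e.
rewrite p0 g_gt0 e_gt0 g1 e1 => H.
have {H} : 2 / 3 * (p - pc) <= p * M p g.
  by apply: H => //; rewrite ?andbT; lra.
rewrite -(ler_pM2l D0) pE.
have -> : Omega * (2 / 3 * (pc + Omega^-1 * e - pc)) = 2 / 3 * e by field; rewrite gt_eqF.
have -> : Omega * ((pc + Omega^-1 * e) * M (pc + Omega^-1 * e) g) =
   (Omega * pc + e) * M (pc + Omega^-1 * e) g by field; rewrite gt_eqF.
rewrite -pE => h.
have : (Omega * pc + e) * M p g <= (203 / 100) * M p g by rewrite ler_wpM2r //; lra.
lra.
Qed.

End Critical.
End Main.

(** Raise the lower bound on eps V r to the power 1 - alpha, and use
    r^(2 - alpha) <= rho.  The exponent 1 - alpha is positive, which is where alpha < 1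
    enters. *)
Lemma window_scaling (R : realType) (alpha lam rho eps V : R) :
  0 <= alpha < 1 -> 0 < lam -> 0 < rho -> 0 < V -> 0 < eps ->
  Num.max 1 (lam `^ (- (1 - alpha)^-1)) / Num.min 1 (rho `^ (2 - alpha)^-1) <= eps * V ->
  eps * Num.min 1 (rho `^ (2 - alpha)^-1) <=
    rho * (eps ^- 2 * (eps * V) `^ alpha)^-1 * (lam * V).
Proof.
move=> /andP[al0 al1] lam0 rho0 V0 e0.
set r := Num.min 1 _; have r0 : 0 < r by rewrite lt_min ltr01 powR_gt0.
set K := eps * V; have K0 : 0 < K by rewrite mulr_gt0.
rewrite ler_pdivrMr // => hK.
have al2 : 0 < 2 - alpha by lra.
have al1' : 0 < 1 - alpha by lra.
have r_rho : r `^ (2 - alpha) <= rho.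
  have := @ge0_ler_powR R (2 - alpha) (ltW al2) r (rho `^ (2 - alpha)^-1).
  rewrite !nnegrE powR_ge0 (ltW r0) -powRrM mulVf ?gt_eqF // powRr1 ?(ltW rho0) // => -> //.
  by rewrite ge_min lexx orbT.
have lamK : lam^-1 <= (K * r) `^ (1 - alpha).
  have := @ge0_ler_powR R (1 - alpha) (ltW al1') (lam `^ (- (1 - alpha)^-1)) (K * r).
  rewrite !nnegrE powR_ge0 mulr_ge0 ?(ltW r0) ?(ltW K0) // -powRrM mulNr mulVf ?gt_eqF //.
  rewrite powR_inv1 ?(ltW lam0) // => -> //.
  by apply: le_trans hK; rewrite le_max lexx orbT.
have KE : K = K `^ alpha * K `^ (1 - alpha).
  by rewrite -powRD; [rewrite addrC subrK powRr1 // (ltW K0) | rewrite (gt_eqF K0) implybT].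
have rE : r `^ (2 - alpha) = r * r `^ (1 - alpha).
  rewrite -{2}(powRr1 (ltW r0)) -powRD; last by rewrite (gt_eqF r0) implybT.
  by congr (_ `^ _); lra.
have Ka0 : 0 < K `^ alpha by rewrite powR_gt0.
have -> : rho * (eps ^- 2 * K `^ alpha)^-1 * (lam * V) = eps * (rho * lam * K `^ (1 - alpha)).
  have -> : eps ^- 2 * K `^ alpha = K `^ alpha / eps ^+ 2 by rewrite mulrC.
  have -> : K `^ (1 - alpha) = K / K `^ alpha by rewrite {2}KE mulrAC divff ?mul1r // gt_eqF.
  rewrite /K; field; rewrite ?gt_eqF //.
rewrite ler_pM2l //.
have rb0 : 0 < r `^ (1 - alpha) by rewrite powR_gt0.
have h : 1 <= lam * (K `^ (1 - alpha) * r `^ (1 - alpha)).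
  have := ler_wpM2l (ltW lam0) lamK; rewrite mulfV ?gt_eqF //.
  by rewrite powRM ?(ltW r0) ?(ltW K0).
rewrite -(ler_pM2r rb0) -rE.
apply: (le_trans r_rho).
have := ler_wpM2l (ltW rho0) h; rewrite mulr1; lra.
Qed.

Theorem theorem1p7 (R : realType) :
  exists (b0 : R) (c : R -> R -> R) (b13 : R -> R -> R -> R),
  [/\ 0 < b0,
      forall alpha lam : R, 0 <= alpha < 1 -> 0 < lam -> 0 < c alpha lam,
      forall alpha lam rho : R,
        0 <= alpha < 1 -> 0 < lam -> 0 < rho -> 0 < b13 alpha lam rho &
      forall (lam : R) (T : finType) (B : {set {set T}}) (o : T) (a0 : R),
        let V13 := cbrtV R T in
        let Omega : R := (degree B o)%:R in
        let pc := critical_threshold B o lam in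
        let chi := chi B o in
        let M := magnetization B o in
        0 < lam ->
        is_graph B -> connected_graph B -> transitive_graph B ->
        1 < lam * V13 < #|T|%:R ->
        a0 <= b0 -> triangle_condition B pc a0 ->
        b0^-1 <= lam * V13 ->
        [/\ (* (i) *)
            forall gamma p : R, 0 <= gamma <= 1 -> 0 <= p <= pc ->
              3^-1 * Num.min (Num.sqrt gamma) (gamma * chi p)
                <= M p gamma
                <= Num.min (Num.sqrt (12 * gamma)) (gamma * chi p),
            (* (ii), upper bound *)
            forall gamma p eps : R, 0 <= gamma <= 1 ->
              p = pc + Omega^-1 * eps -> p <= 1 -> 0 <= eps ->
              M p gamma <= Num.sqrt (12 * gamma) + 13 * eps &
            (* (ii), lower bound *)
            forall alpha rho p eps : R,
              p = pc + Omega^-1 * eps -> p <= 1 -> 0 <= eps ->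
              0 <= alpha < 1 -> 0 < rho ->
              let N := eps ^- 2 * (eps * V13) `^ alpha in
              b13 alpha lam rho * V13^-1 <= eps <= 1 ->
              0 <= rho * N^-1 <= 1 ->
              c alpha lam * eps * Num.min 1 (rho `^ (2 - alpha)^-1)
                <= M p (rho * N^-1)]].
Proof.
pose r alpha rho : R := Num.min 1 (rho `^ (2 - alpha)^-1).
exists 100^-1, (fun _ _ => 6^-1),
  (fun alpha lam rho => Num.max 1 (lam `^ (- (1 - alpha)^-1)) / r alpha rho).
have r_gt0 alpha rho : 0 < rho -> 0 < r alpha rho.
  by move=> rho0; rewrite lt_min ltr01 powR_gt0.
split=> [||alpha lam rho _ _ rho0|].
- by rewrite invr_gt0 ltr0n.
- by move=> *; rewrite invr_gt0 ltr0n.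
- by apply: divr_gt0; [rewrite lt_max ltr01 | apply: r_gt0].
move=> lam T B o a0 V13 Omega pc chi M lam0 gB cB trB lamV a0le tri lamV100.
have [pc01 chipc] := critical_thresholdP o cB lamV.
have chi100 : 100 <= Defs.chi B o pc by rewrite chipc -[leLHS]invrK.
have T1 : (1 < #|T|)%N.
  by case/andP: lamV => h1 h2; rewrite -(ltr_nat R); apply: lt_trans h1 h2.
have tri' x y : x != y -> triangle B pc x y <= 1 / 100.
  by move=> xy; apply: (le_trans (tri x y)); rewrite (negPf xy) add0r div1r.
have V0 : 0 < V13 by rewrite powR_gt0 // ltr0n; apply: leq_trans T1.
split.
- move=> g p g01 ppc; have [pc0 pc1] := andP pc01.
  have p01 : 0 <= p <= 1 by case/andP: ppc => -> /le_trans->.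
  rewrite (mag_lower o gB trB pc01 tri' cB T1 g01 ppc) le_min.
  rewrite (mag_upper gB trB pc01 chi100 tri' cB T1 g01 ppc).
  exact: mag_le_chi.
- move=> g p e g01 pE p1 e0.
  exact: (mag_window gB trB pc01 chi100 tri' cB T1 g01 pE p1 e0).
move=> alpha rho p e pE p1 e0 al01 rho0 N /andP[be e1] g01.
have r0 := r_gt0 alpha rho rho0; have r1 : r alpha rho <= 1 by rewrite ge_min lexx.
have e_gt0 : 0 < e.
  apply: lt_le_trans be; apply: mulr_gt0; last by rewrite invr_gt0.
  by apply: divr_gt0 => //; rewrite lt_max ltr01.
(* the density is lowered to pc + e r / Omega, where gamma chi(pc) >= e r *)
have er : 0 <= e * r alpha rho <= 1.
  by rewrite mulr_ge0 ?(ltW r0) //= mulr_ile1 // ltW.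
have gchi : e * r alpha rho <= rho * N^-1 * Defs.chi B o pc.
  by rewrite chipc; apply: window_scaling => //; rewrite -ler_pdivrMr.
have := mag_supercritical gB trB pc01 chi100 tri' cB T1 g01 er erefl gchi.
rewrite -/(r alpha rho) -mulrA mulrC => h; apply: (le_trans h); apply: mag_le => //.
rewrite pE lerD2l; case/andP: pc01 => pc0 _.
rewrite addr_ge0 ?mulr_ge0 ?invr_ge0 ?(ltW r0) //= ler_wpM2l ?invr_ge0 //.
by rewrite ler_piMr.
Qed.
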